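(* Let $n\ge 3$, let $(F,g_F)$ be an $(n-1)$-dimensional Riemannian manifold with Levi-Civita connection $\nabla^F$, and let $\nabla^F+\omega$ be a metric connection on $F$ with skew-symmetric torsion. Let $f\in C^\infty(\mathbb{R},\mathbb{R}_{+})$, $\varepsilon\in\{1,-1\}$, $M=\mathbb{R}\times F$ with projection $\pi:M\to F$, and consider on $M$ the product metric $g_\varepsilon=\varepsilon\,dt^2+g_F$ and the warped product metric $\tilde g_\varepsilon=\varepsilon\,dt^2+f(t)^2g_F$. Let $V=h\,\partial_t$ with $h\in C^\infty(\mathbb{R})$. Denote by $\widetilde{\mathrm{Ric}}^{\omega,V}_\varepsilon$ the Ricci tensor of the connection $\nabla^{\tilde g_\varepsilon}+\pi^*\omega+A_V$ on $(M,\tilde g_\varepsilon)$ and by $\mathrm{Ric}^\omega_\varepsilon$ the Ricci tensor of the connection $\nabla^{g_\varepsilon}+\pi^*\omega$ on $(M,g_\varepsilon)$. Then $$\widetilde{\mathrm{Ric}}^{\omega,V}_\varepsilon=\mathrm{Ric}^\omega_\varepsilon\quad\text{if and only if}\quad V=\varepsilon\,\frac{\dot f}{f}\,\partial_t .$$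
   Context: $\nabla^{\tilde g_\varepsilon}$, $\nabla^{g_\varepsilon}$ are the Levi-Civita connections. $\omega$ is a $(2,1)$-tensor on $F$ such that $g_F(\omega(X,Y),Z)$ is totally skew-symmetric in $X,Y,Z$, and $(\nabla^F+\omega)_XY=\nabla^F_XY+\omega(X,Y)$. $\pi^*\omega$ is the $(2,1)$-tensor on $M=\mathbb{R}\times F$ with $(\pi^*\omega)(X,Y)$ equal to the vector tangent to $F$ projecting to $\omega(d\pi X,d\pi Y)$; in particular it vanishes if one argument is $\partial_t$. $A_V(X)Y=\tilde g_\varepsilon(X,Y)V-\tilde g_\varepsilon(V,Y)X$. For a metric connection $\nabla$ with curvature $\mathcal{R}(X,Y)Z=\nabla_X\nabla_YZ-\nabla_Y\nabla_XZ-\nabla_{[X,Y]}Z$ on a semi-Riemannian manifold with metric $g$ and orthonormal basis $g(e_i,e_j)=\varepsilon_i\delta_{ij}$, the Ricci tensor is $\mathrm{Ric}(X,Y)=\sum_i\varepsilon_i\,g(\mathcal{R}(X,e_i)e_i,Y)$. A dot denotes $d/dt$. *)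

(* Defs.v *)
From mathcomp Require Import all_boot all_order all_algebra.
From mathcomp Require Import all_classical all_reals all_analysis.

Set Implicit Arguments.
Unset Strict Implicit.
Unset Printing Implicit Defensive.
Import Order.TTheory GRing.Theory Num.Theory.
Import numFieldTopology.Exports numFieldNormedType.Exports.
Local Open Scope classical_set_scope.
Local Open Scope ring_scope.

Fixpoint Ck (R : realType) (V : normedModType R) (k : nat) (U : set V)
    (f : V -> R) : Prop :=
  match k with
  | 0 => forall x, U x -> {for x, continuous f}
  | k'.+1 => (forall x, U x -> differentiable f x)
             /\ forall v : V, Ck k' U ('D_v f)
  end.

Definition smooth_on (R : realType) (V : normedModType R) (U : set V)
    (f : V -> R) : Prop := forall k, Ck k U f.

Definition smoothR (R : realType) (f : R -> R) : Prop :=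
  forall k (t : R), derivable (derive1n k f) t 1.

(* An atlas of the m-dimensional manifold indexed by its points: [chart p] is
   a chart on the open set [cdom p] around [p] and [cinv p] is its inverse. *)
Record manifold (R : realType) (m : nat) := Manifold {
  carrier :> topologicalType;
  chart : carrier -> carrier -> 'rV[R]_m;
  cdom : carrier -> set carrier;
  cinv : carrier -> 'rV[R]_m -> carrier;
  m_hausdorff : hausdorff_space carrier;
  m_second_countable : @second_countable carrier;
  cdom_open : forall p, open (cdom p);
  cdom_mem : forall p, cdom p p;
  cimg_open : forall p, open (chart p @` cdom p);
  chartK : forall p q, cdom p q -> cinv p (chart p q) = q;
  chart_continuous : forall p q, cdom p q -> {for q, continuous (chart p)};
  cinv_continuous : forall p x, (chart p @` cdom p) x ->
    {for x, continuous (cinv p)};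
  chart_compat : forall p q (i : 'I_m),
    smooth_on (chart p @` (cdom p `&` cdom q))
      (fun x => chart q (cinv p x) 0 i)
}.
Arguments chart {R m M} p : rename.
Arguments cdom {R m M} p : rename.
Arguments cinv {R m M} p : rename.

Section LineProduct.
Variables (R : realType) (m : nat) (F : manifold R m).

Local Notation M := (R * F)%type.

Definition line_chart (p q : M) : 'rV[R]_(1 + m) :=
  row_mx (q.1)%:M (chart p.2 q.2).
Definition line_dom (p : M) : set M := [set q | cdom p.2 q.2].
Definition line_cinv (p : M) (x : 'rV[R]_(1 + m)) : M :=
  (lsubmx x 0 0, cinv p.2 (rsubmx x)).

Lemma line_hausdorff : hausdorff_space M.
Proof.
move=> [s p] [t q] pq; congr pair.
- apply: Rhausdorff => A B sA tB.
  have [||[x y] [/= xA xB]] := pq (fst @^-1` A) (fst @^-1` B); last by exists x.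
  + exact: (@cvg_fst _ _ (nbhs s) (nbhs p)).
  + exact: (@cvg_fst _ _ (nbhs t) (nbhs q)).
- apply: (@m_hausdorff _ _ F) => A B pA qB.
  have [||[x y] [/= xA xB]] := pq (snd @^-1` A) (snd @^-1` B); last by exists y.
  + exact: (@cvg_snd _ _ (nbhs s) (nbhs p)).
  + exact: (@cvg_snd _ _ (nbhs t) (nbhs q)).
Qed.

Lemma line_second_countable : @second_countable M.
Proof.
have [B cB [Bo Bb]] := @m_second_countable _ _ F.
pose J (c : rat * rat) : set R := ball (ratr c.1 : R) (ratr c.2).
have cJ : countable (range J) by apply: sub_countable (card_image_le _ _) _.
exists ((fun c : set R * set F => c.1 `*` c.2) @` (range J `*` B)).
  by apply: sub_countable (card_image_le _ _) _; exact: countableX.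
split=> [_ [[U V] /= [[c _ <-] BV] <-]|[s p] A [[U V] /= [sU pV] UVA]].
  rewrite openE => -[x y] [/= Ux Vy].
  exists (J c, V); last by case.
  by split; apply: open_nbhs_nbhs; split => //; [exact: ball_open|exact: Bo].
have [W [oW sW] WU] : exists2 W, open_nbhs s W & W `<=` U.
  by move: sU; rewrite nbhsE => -[W ? ?]; exists W.
have [c [r [sc crW]]] := open_subball_rat oW (mem_set sW).
have [V' [BV' V'p] V'V] := Bb p V pV.
exists (J (c, r) `*` V'); last first.
  by move=> [x y] [/= xJ yV]; apply: UVA; split; [exact/WU/crW|exact: V'V].
split; last by split => //=; exact: set_mem.
by exists (J (c, r), V') => //; split => //; exists (c, r).
Qed.

Lemma line_dom_open p : open (line_dom p).
Proof.
apply: (@open_comp _ _ (@snd R F) (cdom p.2)) => [q _|]; last exact: cdom_open.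
exact: cvg_snd.
Qed.

Lemma line_imgE p : line_chart p @` line_dom p =
  rsubmx @^-1` (chart p.2 @` cdom p.2).
Proof.
apply/seteqP; split=> [_ [q pq <-]|x /= [q pq qx]].
  by rewrite /= /line_chart row_mxKr; exists q.2.
exists (lsubmx x 0 0, q) => //; rewrite /line_chart /= qx -mx11_scalar.
exact: hsubmxK.
Qed.

Lemma line_img_open p : open (line_chart p @` line_dom p).
Proof.
rewrite line_imgE; apply: open_comp; last exact: cimg_open.
by move=> x _; exact: continuous_rsubmx.
Qed.

Lemma line_chartK p q : line_dom p q -> line_cinv p (line_chart p q) = q.
Proof.
case: q => t q pq.
by rewrite /line_cinv /line_chart row_mxKl row_mxKr mxE eqxx mulr1n /= chartK.
Qed.

Lemma continuous_row_mx (T : topologicalType) n1 n2 (x : T)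
    (u : T -> 'rV[R]_n1) (v : T -> 'rV[R]_n2) :
  {for x, continuous u} -> {for x, continuous v} ->
  {for x, continuous (fun y => row_mx (u y) (v y))}.
Proof.
move=> uc vc A /nbhs_ballP[e e0 eA].
have ux : \forall y \near x, ball (u x) e (u y).
  by apply: uc; exact: nbhsx_ballx.
have vx : \forall y \near x, ball (v x) e (v y).
  by apply: vc; exact: nbhsx_ballx.
apply: filterS (filterI ux vx) => y [[_ uy] [_ vy]].
apply: eA; split=> // i j; rewrite !mxE.
by case: fintype.split => k; [exact: uy|exact: vy].
Qed.

Lemma continuous_mx11 (T : topologicalType) (x : T) (u : T -> R) :
  {for x, continuous u} ->
  {for x, continuous (fun y => (u y)%:M : 'rV[R]_1)}.
Proof.
move=> uc A /nbhs_ballP[e e0 eA].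
have ux : \forall y \near x, ball (u x) e (u y).
  by apply: uc; exact: nbhsx_ballx.
apply: filterS ux => y uy.
by apply: eA; split=> // i j; rewrite !mxE !ord1 eqxx !mulr1n.
Qed.

Lemma line_chart_continuous p q :
  line_dom p q -> {for q, continuous (line_chart p)}.
Proof.
move=> pq; apply: continuous_row_mx.
  by apply: continuous_mx11; exact: cvg_fst.
apply: (@continuous_comp _ _ _ snd (chart p.2)); first exact: cvg_snd.
exact: chart_continuous.
Qed.

Lemma line_cinv_continuous p x :
  (line_chart p @` line_dom p) x -> {for x, continuous (line_cinv p)}.
Proof.
rewrite line_imgE => px.
have c1 : {for x, continuous (fun y : 'rV[R]_(1 + m) => lsubmx y 0 0)}.
  apply: (@continuous_comp _ _ _ lsubmx (fun y : 'M[R]_1 => y 0 0)).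
    exact: continuous_lsubmx.
  exact: coord_continuous.
have c2 : {for x, continuous (cinv p.2 \o @rsubmx R 1 1 m)}.
  apply: continuous_comp; first exact: continuous_rsubmx.
  exact: cinv_continuous.
exact: (cvg_pair c1 c2).
Qed.

Lemma Ck_cst (V : normedModType R) k (U : set V) (c : R) : Ck k U (cst c).
Proof.
elim: k c => [|k IH] c /=; first by move=> x _; exact: cst_continuous.
split=> // v; rewrite (_ : 'D_v _ = cst 0); first exact: IH.
by apply/funext => x; exact: derive_cst.
Qed.

Lemma smooth_on_lin (V : normedModType R) (U : set V) (f : {linear V -> R}) :
  continuous f -> smooth_on U f.
Proof.
move=> fc [|k] /=; first by move=> x _; exact: fc.
split=> [x _|v]; first exact: linear_differentiable.
rewrite (_ : 'D_v _ = cst (f v)); first exact: Ck_cst.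
apply/funext => x; rewrite deriveE; last exact: linear_differentiable.
by rewrite diff_lin.
Qed.

Lemma smooth_on_comp_lin (V W : normedModType R) (L : {linear V -> W})
    (U : set W) (f : W -> R) :
  continuous L -> smooth_on U f -> smooth_on (L @^-1` U) (f \o L).
Proof.
move=> Lc sf k; elim: k f {sf}(sf k) => [|k IH] f /=.
  move=> cf x Ux; apply: continuous_comp; [exact: Lc|exact: cf].
move=> [df sf]; split=> [x Ux|v].
  apply: differentiable_comp; last exact: df.
  exact: linear_differentiable.
suff -> : 'D_v (f \o L) = 'D_(L v) f \o L by exact: IH.
apply/funext => x; rewrite /derive /=.
by under eq_fun do rewrite linearP.
Qed.

Lemma line_chart_compat p q (i : 'I_(1 + m)) :
  smooth_on (line_chart p @` (line_dom p `&` line_dom q))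
    (fun x => line_chart q (line_cinv p x) 0 i).
Proof.
have -> : line_chart p @` (line_dom p `&` line_dom q) =
    rsubmx @^-1` (chart p.2 @` (cdom p.2 `&` cdom q.2)).
  apply/seteqP; split=> [_ [r pr <-]|x /= [r pr rx]].
    by rewrite /= /line_chart row_mxKr; exists r.2.
  exists (lsubmx x 0 0, r) => //; rewrite /line_chart /= rx -mx11_scalar.
  exact: hsubmxK.
case: (split_ordP i) => j ->{i}.
  rewrite (_ : (fun _ => _) = (fun x : 'rV[R]_(1 + m) => x 0 (lshift m j))).
    have @c : {linear 'rV[R]_(1 + m) -> R}.
      by exists (fun x : 'rV[R]_(1 + m) => x 0 (lshift m j)); do 2![eexists];
        do ?[constructor]; rewrite ?mxE// => ? *; rewrite ?mxE//;
        move=> ?; rewrite !mxE.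
    apply: (@smooth_on_lin _ _ c).
    exact: (@coord_continuous R 1 (1 + m) 0 (lshift m j)).
  by apply/funext => x; rewrite /line_chart row_mxEl (ord1 j) mxE eqxx mulr1n /= mxE.
rewrite (_ : (fun _ => _) =
    (fun y => chart q.2 (cinv p.2 y) 0 j) \o rsubmx).
  apply: (@smooth_on_comp_lin _ _ (@rsubmx R 1 1 m)).
    exact: continuous_rsubmx.
  exact: chart_compat.
by apply/funext => x; rewrite /line_chart row_mxEr.
Qed.

(* R x F, with the charts (t, q) |-> (t, chart p q) *)
Definition line_product : manifold R (1 + m) :=
  @Manifold R (1 + m) M line_chart line_dom line_cinv line_hausdorff
    line_second_countable line_dom_open (fun p => cdom_mem p.2) line_img_open
    line_chartK line_chart_continuous line_cinv_continuous line_chart_compat.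

End LineProduct.


Section Calculus.
Variables (R : realType) (m : nat) (M : manifold R m).

(* T_pM is 'rV[R]_m: a tangent vector at p is its row of coordinates in
   [chart p], so a vector field X is a map M -> 'rV[R]_m where [X p] is read in
   [chart p].  Smoothness of X is that of the functions X(phi), and does not
   amount to smoothness of this map since [chart p] varies with p. *)

(* v(phi) for v in T_pM *)
Definition dirder (p : M) (v : 'rV[R]_m) (phi : M -> R) : R :=
  'D_v (phi \o cinv p) (chart p p).

Definition fun_smooth_at (phi : M -> R) (p : M) : Prop :=
  exists2 W, open_nbhs (chart p p) W & smooth_on W (phi \o cinv p).

Definition vf_smooth_at (X : M -> 'rV[R]_m) (p : M) : Prop :=
  forall phi, fun_smooth_at phi p ->
    fun_smooth_at (fun q => dirder q (X q) phi) p.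

(* [X, Y]_p, through its action on the coordinate functions of [chart p] *)
Definition lie (X Y : M -> 'rV[R]_m) (p : M) : 'rV[R]_m :=
  \row_k (let xk := fun q => chart p q 0 k in
          dirder p (X p) (fun q => dirder q (Y q) xk)
          - dirder p (Y p) (fun q => dirder q (X q) xk)).

(* the field with the constant coordinates v in [chart p], on [cdom p] *)
Definition coord_field (p : M) (v : 'rV[R]_m) (q : M) : 'rV[R]_m :=
  'D_v (chart q \o cinv p) (chart p q).

Definition bilinear_form (g : M -> 'rV[R]_m -> 'rV[R]_m -> R) : Prop :=
  forall p,
    (forall a x y z, g p (a *: x + y) z = a * g p x z + g p y z) /\
    (forall a x y z, g p z (a *: x + y) = a * g p z x + g p z y).

Definition riemannian (g : M -> 'rV[R]_m -> 'rV[R]_m -> R) : Prop :=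
  [/\ bilinear_form g,
      forall p x y, g p x y = g p y x,
      forall p x, x != 0 -> 0 < g p x x
    & forall p X Y, vf_smooth_at X p -> vf_smooth_at Y p ->
        fun_smooth_at (fun q => g q (X q) (Y q)) p].

Definition tensor21 (om : M -> 'rV[R]_m -> 'rV[R]_m -> 'rV[R]_m) : Prop :=
  [/\ forall p a x y z, om p (a *: x + y) z = a *: om p x z + om p y z,
      forall p a x y z, om p z (a *: x + y) = a *: om p z x + om p z y
    & forall p X Y, vf_smooth_at X p -> vf_smooth_at Y p ->
        vf_smooth_at (fun q => om q (X q) (Y q)) p].

(* g(om(X, Y), Z) is totally skew-symmetric in X, Y, Z *)
Definition skew21 (g : M -> 'rV[R]_m -> 'rV[R]_m -> R)
    (om : M -> 'rV[R]_m -> 'rV[R]_m -> 'rV[R]_m) : Prop :=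
  forall p x y z, g p (om p x y) z = - g p (om p y x) z /\
                  g p (om p x y) z = - g p (om p x z) y.

(* [D p v Y] is D_v Y in T_pM, for v in T_pM and Y a field smooth near p; its
   value on other Y is irrelevant. *)
Definition connection := M -> 'rV[R]_m -> (M -> 'rV[R]_m) -> 'rV[R]_m.

Definition is_connection (D : connection) : Prop :=
  [/\ forall p a v w Y, vf_smooth_at Y p ->
        D p (a *: v + w) Y = a *: D p v Y + D p w Y,
      forall p v Y Z, vf_smooth_at Y p -> vf_smooth_at Z p ->
        D p v (fun q => Y q + Z q) = D p v Y + D p v Z,
      forall p v phi Y, fun_smooth_at phi p -> vf_smooth_at Y p ->
        D p v (fun q => phi q *: Y q) =
          dirder p v phi *: Y p + phi p *: D p v Y,
      forall p v Y Z, vf_smooth_at Y p -> (\forall q \near p, Y q = Z q) ->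
        D p v Y = D p v Z
    & forall p X Y, vf_smooth_at X p -> vf_smooth_at Y p ->
        vf_smooth_at (fun q => D q (X q) Y) p].

Definition metric_connection (g : M -> 'rV[R]_m -> 'rV[R]_m -> R)
    (D : connection) : Prop :=
  is_connection D /\
  forall p v Y Z, vf_smooth_at Y p -> vf_smooth_at Z p ->
    dirder p v (fun q => g q (Y q) (Z q)) =
      g p (D p v Y) (Z p) + g p (Y p) (D p v Z).

Definition torsion (D : connection) (X Y : M -> 'rV[R]_m) (p : M) : 'rV[R]_m :=
  D p (X p) Y - D p (Y p) X - lie X Y p.

Definition skew_torsion (g : M -> 'rV[R]_m -> 'rV[R]_m -> R)
    (D : connection) : Prop :=
  forall p X Y Z, vf_smooth_at X p -> vf_smooth_at Y p -> vf_smooth_at Z p ->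
    g p (torsion D X Y p) (Z p) = - g p (torsion D Y X p) (Z p) /\
    g p (torsion D X Y p) (Z p) = - g p (torsion D X Z p) (Y p).

Definition levi_civita (g : M -> 'rV[R]_m -> 'rV[R]_m -> R)
    (D : connection) : Prop :=
  metric_connection g D /\
  forall p X Y, vf_smooth_at X p -> vf_smooth_at Y p -> torsion D X Y p = 0.

Definition conn_add (D : connection)
    (A : M -> 'rV[R]_m -> 'rV[R]_m -> 'rV[R]_m) : connection :=
  fun p v Y => D p v Y + A p v (Y p).

Definition curvature (D : connection) (X Y Z : M -> 'rV[R]_m) (p : M) :
    'rV[R]_m :=
  D p (X p) (fun q => D q (Y q) Z) - D p (Y p) (fun q => D q (X q) Z)
  - D p (lie X Y p) Z.

(* the curvature tensor at p; the vectors are extended to fields near p *)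
Definition curv (D : connection) (p : M) (x y z : 'rV[R]_m) : 'rV[R]_m :=
  curvature D (coord_field p x) (coord_field p y) (coord_field p z) p.

(* the rows of e are a basis of T_pM with g(e_i, e_j) = eps_i delta_ij *)
Definition is_onb (g : M -> 'rV[R]_m -> 'rV[R]_m -> R) (p : M)
    (e : 'M[R]_m) : Prop :=
  forall i j, if i == j then g p (row i e) (row i e) = 1 \/
                             g p (row i e) (row i e) = -1
              else g p (row i e) (row j e) = 0.

Definition onb (g : M -> 'rV[R]_m -> 'rV[R]_m -> R) (p : M) : 'M[R]_m :=
  xget 0 [set e | is_onb g p e].

Definition ricci (g : M -> 'rV[R]_m -> 'rV[R]_m -> R) (D : connection)
    (p : M) (x y : 'rV[R]_m) : R :=
  \sum_(i < m) let e := row i (onb g p) in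
    g p e e * g p (curv D p x e e) y.

End Calculus.

(* the differential of phi at p, from T_pM to T_(phi p)N *)
Definition mdiff (R : realType) (m k : nat) (M : manifold R m)
    (N : manifold R k) (phi : M -> N) (p : M) (v : 'rV[R]_m) : 'rV[R]_k :=
  'D_v (chart (phi p) \o phi \o cinv p) (chart p p).

Section WarpedLine.
Variables (R : realType) (m : nat) (F : manifold R m).
Local Notation M := (line_product F).
Implicit Types z : M.

Definition tcoord z : R := z.1.
Definition projF z : F := z.2.

Definition dt z (x : 'rV[R]_(1 + m)) : R := dirder z x tcoord.
Definition dprojF z (x : 'rV[R]_(1 + m)) : 'rV[R]_m := mdiff projF z x.

(* the velocity at z of the curve s |-> (s, projF z) *)
Definition partial_t z : 'rV[R]_(1 + m) :=
  derive1 (fun s : R => chart z ((s, projF z) : M)) (tcoord z).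

(* the vector at z tangent to F that dprojF maps to w *)
Definition tangentF z (w : 'rV[R]_m) : 'rV[R]_(1 + m) :=
  mdiff (fun q : F => (tcoord z, q) : M) (projF z) w.

Definition warped (eps : R) (f : R -> R)
    (gF : F -> 'rV[R]_m -> 'rV[R]_m -> R) z (x y : 'rV[R]_(1 + m)) : R :=
  eps * (dt z x * dt z y)
  + f (tcoord z) ^+ 2 * gF (projF z) (dprojF z x) (dprojF z y).

Definition product_metric (eps : R) (gF : F -> 'rV[R]_m -> 'rV[R]_m -> R)
    z (x y : 'rV[R]_(1 + m)) : R :=
  eps * (dt z x * dt z y) + gF (projF z) (dprojF z x) (dprojF z y).

Definition pullback (om : F -> 'rV[R]_m -> 'rV[R]_m -> 'rV[R]_m)
    z (x y : 'rV[R]_(1 + m)) : 'rV[R]_(1 + m) :=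
  tangentF z (om (projF z) (dprojF z x) (dprojF z y)).

End WarpedLine.

(* A_V(X)Y = g(X, Y) V - g(V, Y) X *)
Definition vectorial (R : realType) (m : nat) (M : manifold R m)
    (g : M -> 'rV[R]_m -> 'rV[R]_m -> R) (V : M -> 'rV[R]_m)
    (p : M) (x y : 'rV[R]_m) : 'rV[R]_m :=
  g p x y *: V p - g p (V p) y *: x.

(* Main.v *)
Require Import Defs.
From mathcomp Require Import all_boot all_order all_algebra.
From mathcomp Require Import all_classical all_reals all_analysis.
From mathcomp Require Import ring lra.

Set Implicit Arguments.
Unset Strict Implicit.
Unset Printing Implicit Defensive.
Import Order.TTheory GRing.Theory Num.Theory.
Import numFieldTopology.Exports numFieldNormedType.Exports.
Local Open Scope classical_set_scope.
Local Open Scope ring_scope.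

(* Put a = f'/f and write V = (u + eps a) d/dt. By the Koszul argument d/dt is
   parallel for the Levi-Civita connection of the product metric, hence also for
   D0 = that connection + pi^* omega. Uniqueness of the Levi-Civita connection of
   the warped metric then gives, with P the projection to TF,
     D1 X Y = D0 X Y + u f^2 g_F(PX, PY) d/dt - eps u dt(Y) PX + a dt(X) PY
   for the connection D1 of the theorem. If u = 0 the correction is the closed
   form a dt times the D0-parallel projection P, so that D0 and D1 have the same
   curvature; since this curvature kills d/dt and takes values in TF, and the
   inverse metric on TF scales by f^-2, the Ricci tensors agree. Conversely let
   k = u' + u a. Then Ric1(d/dt, d/dt) = eps (n - 1) k while Ric0(d/dt, d/dt) = 0,
   so k = 0, and for a g_F-unit vector x of F this leaves
   Ric1(x, x) = Ric0(x, x) - eps (n - 2) u^2 f^2, so u = 0 as n >= 3. *)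

(** * Smooth functions on normed spaces *)

(** The torsion of D0 does not cancel in the comparison: the curvature of D1 contains N(x, y) - N(y,
    x), where N denotes the Christoffel symbols of D0. The evaluations of the Ricci tensor are
    chosen so that this term drops out. The symbols vanish as soon as one argument is d/dt; and when
    all curvature arguments are tangent to F, the torsion term of the F-part has the coefficient eps
    u dt(z) = 0, while its d/dt part is invisible to a test vector tangent to F. The coefficients of
    the correction are u f^2, eps u and a. The curvature sees the first two only through al' - al a,
    be' + a be and al be. The first two of these expressions are both multiples of k = u' + u a,
    which is why the test on d/dt has to precede the one on F. The latter gives u^2 = 0 at each t
    separately, without solving a differential equation. The rules of a connection hold only for
    fields smooth near the point, and the curvature at p is computed on coordinate fields around p.
    Each comparison is therefore made for fields near p before it is differentiated, and smoothness
    of every intermediate field is carried along. *)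

Section SmoothFunctions.
Variable R : realType.

(** After subtracting [f] it suffices to treat a function vanishing near [x]; the zero map is its
    differential because the error term is eventually exactly 0. *)
Lemma near_eq_differentiable (V W : normedModType R) (f g : V -> W) x :
  (\forall y \near x, f y = g y) -> differentiable f x -> differentiable g x.
Proof.
move=> fg df.
suff d0 : forall h : V -> W, (\forall y \near x, h y = 0) -> differentiable h x.
  rewrite (_ : g = f + (g - f)); last by rewrite addrC subrK.
  apply: differentiableD => //; apply: d0.
  by apply: filterS fg => y fgy; rewrite !fctE fgy subrr.
move=> h h0.
have E : h \o shift x = cst (h x) + (\0 : {linear V -> W}) +o_ 0 id.
  apply/eqaddoP => _/posnumP[e]; rewrite !fctE /=.
  have h0' : \forall y \near (0 : V), h (y + x) = 0.
    by move: h0; rewrite (near_shift 0) /= subr0.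
  apply: filterS h0' => y hy.
  by rewrite hy (nbhs_singleton h0) addr0 subr0 normr0 mulr_ge0.
have c0 : continuous (\0 : {linear V -> W}) by move=> z; exact: cst_continuous.
have D := diff_unique c0 E.
by apply/diff_locallyP; rewrite D; split.
Qed.

Variable V : normedModType R.
Implicit Types (U : set V) (f g : V -> R).

Lemma Ck_sub k U U' f : U' `<=` U -> Ck k U f -> Ck k U' f.
Proof.
elim: k f => [|k IH] f UU /=; first by move=> cf x /UU; exact: cf.
move=> [df Df]; split=> [x /UU|v]; first exact: df.
exact: IH.
Qed.

Lemma CkS k U f : Ck k.+1 U f -> Ck k U f.
Proof.
elim: k f => [|k IH] f [df Df] /=.
  by move=> x /df; exact: differentiable_continuous.
by split=> // v; exact: IH.
Qed.

(** Openness of [U] turns equality on [U] into equality near each of its points, so the directional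
    derivatives agree on [U] again and the induction continues. *)
Lemma Ck_eq k U f g : open U -> (forall x, U x -> f x = g x) ->
  Ck k U f -> Ck k U g.
Proof.
move=> oU; elim: k f g => [|k IH] f g fg /=.
  move=> cf x Ux; rewrite /prop_for /continuous_at -fg //.
  apply: cvg_trans (cf x Ux); apply: near_eq_cvg.
  by near=> y; rewrite fg//; near: y; exact: open_nbhs_nbhs.
have fgn x : U x -> \forall y \near x, f y = g y.
  by move=> Ux; near=> y; apply: fg; near: y; exact: open_nbhs_nbhs.
move=> [df Df]; split=> [x Ux|v].
  by apply: near_eq_differentiable (df x Ux); exact: fgn.
apply: (IH _ _ _ (Df v)) => x Ux; apply: near_eq_derive; exact: fgn.
Unshelve. all: by end_near. Qed.

Lemma CkD k U f g : open U -> Ck k U f -> Ck k U g -> Ck k U (fun x => f x + g x).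
Proof.
move=> oU; elim: k f g => [|k IH] f g /=.
  by move=> cf cg x Ux; apply: cvgD; [exact: cf|exact: cg].
move=> [df Df] [dg Dg]; split=> [x Ux|v].
  by apply: differentiableD; [exact: df|exact: dg].
apply: (Ck_eq oU) (IH _ _ (Df v) (Dg v)) => x Ux.
by rewrite [RHS]deriveD //; apply: diff_derivable; [exact: df|exact: dg].
Qed.

Lemma CkM k U f g : open U -> Ck k U f -> Ck k U g -> Ck k U (fun x => f x * g x).
Proof.
move=> oU; elim: k f g => [|k IH] f g.
  by move=> cf cg x Ux; apply: cvgM; [exact: cf|exact: cg].
move=> cf cg; have [df Df] := cf; have [dg Dg] := cg; split=> [x Ux|v].
  by apply: differentiableM; [exact: df|exact: dg].
(* The Leibniz rule leaves one factor undifferentiated; [CkS] lowers it to the order of the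
   induction hypothesis. *)
apply: (Ck_eq oU) (CkD oU (IH _ _ (CkS cf) (Dg v)) (IH _ _ (CkS cg) (Df v))).
move=> x Ux.
by rewrite [RHS]deriveM //; apply: diff_derivable; [exact: df|exact: dg].
Qed.

Lemma CkV k U f : open U -> (forall x, U x -> f x != 0) -> Ck k U f ->
  Ck k U (fun x => (f x)^-1).
Proof.
move=> oU f0; elim: k => [|k IH].
  by move=> cf x Ux; apply: cvgV; [exact: f0|exact: cf].
move=> cf; have [df Df] := cf; split=> [x Ux|v].
  by apply: differentiableV; [exact: df|exact: f0].
have cV := IH (CkS cf).
(* The derivative of 1/f is -(1/f)^2 D_v f, so the induction hypothesis is used on 1/f itself. *)
apply: (Ck_eq oU) (CkM oU (CkM oU (Ck_cst k U (-1)) (CkM oU cV cV)) (Df v)).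
move=> x Ux; rewrite [RHS]deriveV; last 2 first.
- exact: f0.
- exact/diff_derivable/df.
by rewrite /GRing.scale /= mulN1r expr2 invfM.
Qed.

Lemma Ck_sum k U n (f : 'I_n -> V -> R) : open U -> (forall i, Ck k U (f i)) ->
  Ck k U (fun x => \sum_(i < n) f i x).
Proof.
move=> oU; elim: n f => [|n IH] f cf.
  by under [X in Ck _ _ X]eq_fun do rewrite big_ord0; exact: Ck_cst.
under [X in Ck _ _ X]eq_fun do rewrite big_ord_recr /=.
apply: CkD => //; exact: IH.
Qed.

End SmoothFunctions.

(** * Directional derivatives of row-valued maps *)

Section RowValued.
Variables (R : realType) (V : normedModType R).

Lemma continuous_row (T : topologicalType) m (g : T -> 'rV[R]_m) x :
  (forall i, {for x, continuous (fun y => g y 0 i)}) -> {for x, continuous g}.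
Proof.
move=> gc A /nbhs_ballP[e e0 eA].
have gx : \forall y \near x, forall i, ball (g x 0 i) e (g y 0 i).
  by apply: filter_forall => i; apply: gc; exact: nbhsx_ballx.
apply: filterS gx => y gy.
by apply: eA; split=> // i j; rewrite !ord1; exact: gy.
Qed.

Lemma differentiable_row m (g : V -> 'rV[R]_m) x :
  (forall i, differentiable (fun y => g y 0 i) x) -> differentiable g x.
Proof.
move=> dg; rewrite (_ : g = \sum_(i < m) (fun y => g y 0 i *: delta_mx 0 i)).
  by apply: differentiable_sum => i; exact: differentiableZl.
by apply/funext => y; rewrite fct_sumE {1}[g y]row_sum_delta.
Qed.

Lemma derive_row m (g : V -> 'rV[R]_m) x v i :
  differentiable g x -> ('D_v g x) 0 i = 'D_v (fun y => g y 0 i) x.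
Proof. by move=> dg; rewrite derive_mx ?mxE//; exact: diff_derivable. Qed.

Lemma derive_comp (W X : normedModType R) (g : V -> W) (f : W -> X) x v :
  differentiable g x -> differentiable f (g x) ->
  'D_v (f \o g) x = 'D_('D_v g x) f (g x).
Proof.
move=> dg df; rewrite deriveE; last exact: differentiable_comp.
by rewrite diff_comp //= -!deriveE.
Qed.

Lemma derive_is_linear (W : normedModType R) (f : V -> W) x a v w :
  differentiable f x -> 'D_(a *: v + w) f x = a *: 'D_v f x + 'D_w f x.
Proof. by move=> df; rewrite !deriveE // linearP. Qed.

Lemma derive_sum_dir (W : normedModType R) (f : V -> W) x n (c : 'I_n -> R)
    (v : 'I_n -> V) : differentiable f x ->
  'D_(\sum_i c i *: v i) f x = \sum_i c i *: 'D_(v i) f x.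
Proof.
move=> df; rewrite deriveE // linear_sum; apply: eq_bigr => i _.
by rewrite linearZ deriveE.
Qed.

End RowValued.

Lemma derive_coord (R : realType) m (x v : 'rV[R]_m) k :
  'D_v (fun y : 'rV[R]_m => y 0 k) x = v 0 k.
Proof.
by rewrite -[v in RHS](derive_id x) derive_row.
Qed.

(** * Composition of smooth maps *)

Section SmoothComposition.
Variables (R : realType) (V : normedModType R).
Implicit Types (U : set V) (f : V -> R).

(** The chain rule yields a derivative of [f] in the direction D_v g(x), which moves with x, whereas
    [Ck] only speaks of fixed directions. Expanding that direction in the standard basis gives fixed
    partial derivatives with coefficients D_v g_i, to which the induction applies. *)
Lemma Ck_comp k m U (W : set 'rV[R]_m) (g : V -> 'rV[R]_m)
    (f : 'rV[R]_m -> R) : open U ->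
  (forall x, U x -> W (g x)) -> (forall i, Ck k U (fun x => g x 0 i)) ->
  Ck k W f -> Ck k U (f \o g).
Proof.
move=> oU UW; elim: k f => [|k IH] f cg.
  move=> cf x Ux; apply: continuous_comp; last exact/cf/UW.
  by apply: continuous_row => i; exact: cg.
have dg x : U x -> differentiable g x.
  by move=> Ux; apply: differentiable_row => i; case: (cg i) => + _; exact.
move=> [df Df]; split=> [x Ux|v].
  by apply: differentiable_comp; [exact: dg|exact/df/UW].
pose s x := \sum_i 'D_v (fun y => g y 0 i) x * ('D_(delta_mx 0 i) f \o g) x.
apply: (@Ck_eq _ _ _ _ s) => //.
  move=> x Ux; rewrite derive_comp; [|exact: dg|exact/df/UW].
  have := derive_sum_dir (fun i => ('D_v g x) 0 i)
    (fun i => delta_mx 0 i : 'rV[R]_m) (df _ (UW _ Ux)).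
  rewrite -row_sum_delta => ->.
  by apply: eq_bigr => i _; rewrite derive_row //; exact: dg.
apply: Ck_sum => // i; apply: CkM => //; first exact: (cg i).2.
by apply: IH => [j|]; [exact: CkS|exact: Df].
Qed.

Lemma smooth_on_D U f v : smooth_on U f -> smooth_on U ('D_v f).
Proof. by move=> sf k; exact: (sf k.+1).2. Qed.

End SmoothComposition.

(** * Functions and vector fields on a manifold *)

Section ManifoldCalculus.
Variables (R : realType) (m : nat) (M : manifold R m).
Implicit Types (p q : M) (v w : 'rV[R]_m) (phi psi : M -> R)
  (X Y : M -> 'rV[R]_m).

Lemma near_cdom p q : cdom p q -> \forall r \near q, cdom p r.
Proof. by move=> pq; apply: open_nbhs_nbhs; split=> //; exact: cdom_open. Qed.

(** [cinv p] is continuous on the open image of its chart, so near a point coming from the overlap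
    its values stay in the open set [cdom q]. *)
Lemma overlap_open p q : open (chart p @` (cdom p `&` cdom q)).
Proof.
rewrite openE => _ [r [pr qr] <-]; rewrite /interior.
have cx : \forall y \near chart p r, cdom q (cinv p y).
  have := @cinv_continuous _ _ M p (chart p r) (imageP _ pr).
  by rewrite /prop_for /continuous_at chartK //; apply; exact: near_cdom.
have ix : \forall y \near chart p r, (chart p @` cdom p) y.
  by apply: open_nbhs_nbhs; split; [exact: cimg_open|exact: imageP].
apply: filterS (filterI cx ix) => x [qx [s ps sx]].
by move: qx; rewrite -sx chartK // => qs; exists s.
Qed.

Lemma cinvK p x : (chart p @` cdom p) x -> chart p (cinv p x) = x.
Proof. by move=> [r pr <-]; rewrite chartK. Qed.

Lemma near_cinv p q (A : set M) : cdom p q -> nbhs q A ->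
  \forall x \near chart p q, (chart p @` cdom p) x /\ A (cinv p x).
Proof.
move=> pq qA; near=> x; split; near: x.
  by apply: open_nbhs_nbhs; split; [exact: cimg_open|exact: imageP].
have := @cinv_continuous _ _ M p (chart p q) (imageP _ pq).
by rewrite /prop_for /continuous_at chartK //; apply.
Unshelve. all: by end_near. Qed.

Lemma near_chart p q (A : set 'rV[R]_m) : cdom p q -> nbhs (chart p q) A ->
  \forall r \near q, cdom p r /\ A (chart p r).
Proof.
move=> pq qA; apply: filterI; first exact: near_cdom.
exact: (@chart_continuous _ _ M p q pq).
Qed.

Lemma transition_differentiable p q r : cdom p r -> cdom q r ->
  differentiable (chart q \o cinv p) (chart p r).
Proof.
move=> pr qr; apply: differentiable_row => i.
by apply: (@chart_compat _ _ M p q i 1%N).1; exists r.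
Qed.

(** [fun_smooth_at] is tied to the chart indexed by the very point considered; here the chart stays
    fixed while the point moves. *)
Definition smooth_in_chart p (x : 'rV[R]_m) phi :=
  exists2 W, open_nbhs x W & smooth_on W (phi \o cinv p).

(** On the part of the overlap that the transition map sends into [W], the second reading of [phi]
    is the first one composed with the smooth transition map. *)
Lemma smooth_change p p' q phi : cdom p q -> cdom p' q ->
  smooth_in_chart p (chart p q) phi -> smooth_in_chart p' (chart p' q) phi.
Proof.
move=> pq p'q [W [oW Wq] sW].
pose T := chart p' @` (cdom p' `&` cdom p).
have oT : open T by exact: overlap_open.
pose U := T `&` (chart p \o cinv p') @^-1` W.
have oU : open U.
  rewrite openE => _ [[r [p'r pr] <-] Wr]; rewrite /interior.
  apply: filterI; first by apply: open_nbhs_nbhs; split => //; exists r.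
  have := differentiable_continuous (transition_differentiable p'r pr).
  by apply; apply: open_nbhs_nbhs; split.
have Ur : U (chart p' q) by split; [exists q|rewrite /= chartK].
exists U => // k.
apply: (@Ck_eq _ _ k U ((phi \o cinv p) \o (chart p \o cinv p'))) => //.
  by move=> _ [[r [p'r pr] <-] _] /=; rewrite chartK // chartK.
apply: (Ck_comp oU) (sW k) => [x [] //|i].
by apply: Ck_sub (@chart_compat _ _ M p' p i k) => x [].
Qed.

Lemma fun_smooth_chart p q phi : cdom p q ->
  fun_smooth_at phi q <-> smooth_in_chart p (chart p q) phi.
Proof.
by move=> pq; split; apply: smooth_change => //; exact: cdom_mem.
Qed.

Lemma smooth_in_chart_near p q phi : cdom p q ->
  smooth_in_chart p (chart p q) phi -> \forall r \near q, fun_smooth_at phi r.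
Proof.
move=> pq [W [oW Wq] sW].
have := near_chart pq (open_nbhs_nbhs (conj oW Wq)).
by apply: filterS => r [pr Wr]; apply/(fun_smooth_chart _ pr); exists W.
Qed.

Lemma fun_smooth_near p phi : fun_smooth_at phi p ->
  \forall q \near p, fun_smooth_at phi q.
Proof. exact/smooth_in_chart_near/cdom_mem. Qed.

Lemma fun_smooth_diff p q phi : cdom p q -> fun_smooth_at phi q ->
  differentiable (phi \o cinv p) (chart p q).
Proof.
by move=> pq /(fun_smooth_chart _ pq)[W [oW Wq] sW]; exact: (sW 1%N).1.
Qed.

Lemma near_eq_cinv p q phi psi : cdom p q -> (\forall r \near q, phi r = psi r) ->
  \forall x \near chart p q, (phi \o cinv p) x = (psi \o cinv p) x.
Proof. by move=> pq /(near_cinv pq); apply: filterS => x []. Qed.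

Lemma fun_smooth_eq p phi psi : (\forall q \near p, phi q = psi q) ->
  fun_smooth_at phi p -> fun_smooth_at psi p.
Proof.
move=> /(near_eq_cinv (cdom_mem p)).
rewrite /prop_near1 nbhsE => -[U [oU Up] UE].
move=> [W [oW Wp] sW]; exists (U `&` W).
  by split; [exact: openI|].
move=> k; apply: (@Ck_eq _ _ k _ (phi \o cinv p)).
- exact: openI.
- by move=> x [/UE].
- by apply: Ck_sub (sW k) => x [].
Qed.

Lemma fun_smoothD p phi psi : fun_smooth_at phi p -> fun_smooth_at psi p ->
  fun_smooth_at (fun q => phi q + psi q) p.
Proof.
move=> [W [oW Wp] sW] [W' [oW' Wp'] sW']; exists (W `&` W').
  by split; [exact: openI|].
move=> k; apply: CkD; first exact: openI.
- by apply: Ck_sub (sW k) => x [].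
- by apply: Ck_sub (sW' k) => x [].
Qed.

Lemma fun_smoothM p phi psi : fun_smooth_at phi p -> fun_smooth_at psi p ->
  fun_smooth_at (fun q => phi q * psi q) p.
Proof.
move=> [W [oW Wp] sW] [W' [oW' Wp'] sW']; exists (W `&` W').
  by split; [exact: openI|].
move=> k; apply: CkM; first exact: openI.
- by apply: Ck_sub (sW k) => x [].
- by apply: Ck_sub (sW' k) => x [].
Qed.

Lemma fun_smoothV p phi : (forall q, phi q != 0) -> fun_smooth_at phi p ->
  fun_smooth_at (fun q => (phi q)^-1) p.
Proof.
move=> phi0 [W [oW Wp] sW]; exists W => // k.
by apply: CkV => // x _ /=; exact: phi0.
Qed.

Lemma fun_smooth_cst p (c : R) : fun_smooth_at (fun=> c) p.
Proof.
exists setT; last by move=> k; exact: Ck_cst.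
by split => //; exact: openT.
Qed.

Lemma fun_smooth_sum p n (phi : 'I_n -> M -> R) :
  (forall i, fun_smooth_at (phi i) p) ->
  fun_smooth_at (fun q => \sum_(i < n) phi i q) p.
Proof.
elim: n phi => [|n IH] phi sp.
  under [X in fun_smooth_at X]eq_fun do rewrite big_ord0.
  exact: fun_smooth_cst.
under [X in fun_smooth_at X]eq_fun do rewrite big_ord_recr /=.
by apply: fun_smoothD => //; exact: IH.
Qed.

Lemma smooth_coord (U : set 'rV[R]_m) k : smooth_on U (fun x => x 0 k).
Proof.
have @c : {linear 'rV[R]_m -> R}.
  by exists (fun x : 'rV[R]_m => x 0 k); do 2![eexists];
    do ?[constructor]; rewrite ?mxE// => ? *; rewrite ?mxE//;
    move=> ?; rewrite !mxE.
apply: (@smooth_on_lin _ _ U c); exact: (@coord_continuous R 1 m 0 k).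
Qed.

Lemma chart_coord_smooth p q k : cdom p q ->
  fun_smooth_at (fun r => chart p r 0 k) q.
Proof.
move=> pq; apply/(fun_smooth_chart _ pq); exists (chart p @` cdom p).
  by split; [exact: cimg_open|exists q].
move=> j; apply: (@Ck_eq R 'rV[R]_m j _ (fun x : 'rV[R]_m => x 0 k)); first exact: cimg_open.
  by move=> x px /=; rewrite cinvK.
exact: smooth_coord.
Qed.

Lemma dirder_eq p v phi psi : (\forall q \near p, phi q = psi q) ->
  dirder p v phi = dirder p v psi.
Proof. by move=> E; apply/near_eq_derive/near_eq_cinv => //; exact: cdom_mem. Qed.

Lemma dirder_cst p v (c : R) : dirder p v (fun=> c) = 0.
Proof. exact: derive_cst. Qed.

Lemma dirder_linear p a v w phi : fun_smooth_at phi p ->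
  dirder p (a *: v + w) phi = a * dirder p v phi + dirder p w phi.
Proof.
by move=> sp; apply: derive_is_linear; apply: fun_smooth_diff; first exact: cdom_mem.
Qed.

Lemma dirder0 p phi : dirder p 0 phi = 0.
Proof. exact: derive0. Qed.

Lemma dirderD p v phi psi : fun_smooth_at phi p -> fun_smooth_at psi p ->
  dirder p v (fun q => phi q + psi q) = dirder p v phi + dirder p v psi.
Proof.
move=> sp sq; rewrite {1}/dirder [LHS]deriveD //;
  by apply/diff_derivable/fun_smooth_diff => //; exact: cdom_mem.
Qed.

Lemma dirderM p v phi psi : fun_smooth_at phi p -> fun_smooth_at psi p ->
  dirder p v (fun q => phi q * psi q) =
    phi p * dirder p v psi + psi p * dirder p v phi.
Proof.
move=> sp sq; rewrite {1}/dirder [LHS]deriveM /= ?chartK //;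
  try exact: cdom_mem;
  by apply/diff_derivable/fun_smooth_diff => //; exact: cdom_mem.
Qed.

Lemma dirderZ p v c phi : fun_smooth_at phi p ->
  dirder p v (fun q => c * phi q) = c * dirder p v phi.
Proof.
move=> sp; rewrite dirderM //; last exact: fun_smooth_cst.
by rewrite dirder_cst mulr0 addr0.
Qed.

Lemma vf_smooth_eq p X Y : (\forall q \near p, X q = Y q) ->
  vf_smooth_at X p -> vf_smooth_at Y p.
Proof.
move=> XY sX phi /sX; apply: fun_smooth_eq.
by apply: filterS XY => q ->.
Qed.

Lemma vf_smooth_lin p X Y phi : fun_smooth_at phi p -> vf_smooth_at X p ->
  vf_smooth_at Y p -> vf_smooth_at (fun q => phi q *: X q + Y q) p.
Proof.
move=> sphi sX sY psi spsi.
apply: (@fun_smooth_eq _ (fun q => phi q * dirder q (X q) psi + dirder q (Y q) psi)).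
  by apply: filterS (fun_smooth_near spsi) => q sq; rewrite dirder_linear.
by apply: fun_smoothD; [apply: fun_smoothM => //; exact: sX|exact: sY].
Qed.

Lemma vf_smooth0 p : vf_smooth_at (fun=> 0 : 'rV[R]_m) p.
Proof.
move=> phi _; apply: fun_smooth_eq (fun_smooth_cst p 0).
by apply: nearW => q; rewrite dirder0.
Qed.

Lemma vf_smoothD p X Y : vf_smooth_at X p -> vf_smooth_at Y p ->
  vf_smooth_at (fun q => X q + Y q) p.
Proof.
move=> sX sY; have := vf_smooth_lin (fun_smooth_cst p 1) sX sY.
by apply: vf_smooth_eq; apply: nearW => q; rewrite scale1r.
Qed.

Lemma vf_smoothZ p X phi : fun_smooth_at phi p -> vf_smooth_at X p ->
  vf_smooth_at (fun q => phi q *: X q) p.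
Proof.
move=> sphi sX; have := vf_smooth_lin sphi sX (@vf_smooth0 p).
by apply: vf_smooth_eq; apply: nearW => q; rewrite addr0.
Qed.

Lemma vf_smoothB p X Y : vf_smooth_at X p -> vf_smooth_at Y p ->
  vf_smooth_at (fun q => X q - Y q) p.
Proof.
move=> sX sY; have := vf_smooth_lin (fun_smooth_cst p (-1)) sY sX.
by apply: vf_smooth_eq; apply: nearW => q; rewrite scaleN1r addrC.
Qed.

Lemma vf_smooth_sum p n (X : 'I_n -> M -> 'rV[R]_m) :
  (forall i, vf_smooth_at (X i) p) ->
  vf_smooth_at (fun q => \sum_(i < n) X i q) p.
Proof.
elim: n X => [|n IH] X sX.
  under [Z in vf_smooth_at Z]eq_fun do rewrite big_ord0.
  exact: vf_smooth0.
under [Z in vf_smooth_at Z]eq_fun do rewrite big_ord_recr /=.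
by apply: vf_smoothD => //; exact: IH.
Qed.

(** [coord_field] is the derivative of the transition map, so by the chain rule it acts on functions
    as a partial derivative in the chart at [p]. *)
Lemma dirder_coord_field p q v phi : cdom p q -> fun_smooth_at phi q ->
  dirder q (coord_field p v q) phi = 'D_v (phi \o cinv p) (chart p q).
Proof.
move=> pq sq; have qq := cdom_mem q.
have dq : differentiable (phi \o cinv q) ((chart q \o cinv p) (chart p q)).
  by rewrite /= chartK //; exact: fun_smooth_diff.
have := derive_comp v (transition_differentiable pq qq) dq.
rewrite /= chartK // -/(coord_field p v q) -/(dirder _ _ _) => <-.
apply: near_eq_derive.
apply: filterS (near_cinv pq (near_cdom qq)) => x [px qx] /=.
by rewrite chartK.
Qed.

Lemma coord_field_smooth p q v : cdom p q -> vf_smooth_at (coord_field p v) q.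
Proof.
move=> pq phi sphi.
apply: (@fun_smooth_eq _ (fun r => 'D_v (phi \o cinv p) (chart p r))).
  by apply: filterS (filterI (near_cdom pq) (fun_smooth_near sphi)) =>
    r [pr sr]; rewrite dirder_coord_field.
apply/(fun_smooth_chart _ pq).
have /(fun_smooth_chart _ pq)[W [oW Wq] sW] := sphi.
exists (W `&` (chart p @` cdom p)).
  by split; [apply: openI => //; exact: cimg_open|split => //; exists q].
move=> k; apply: (@Ck_eq _ _ k _ ('D_v (phi \o cinv p))).
- by apply: openI => //; exact: cimg_open.
- by move=> x [_ px] /=; rewrite cinvK.
- by apply: Ck_sub (smooth_on_D v sW k) => x [].
Qed.

Lemma coord_field_linear p q a v w : cdom p q ->
  coord_field p (a *: v + w) q = a *: coord_field p v q + coord_field p w q.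
Proof.
move=> pq; apply: derive_is_linear; apply: transition_differentiable => //.
exact: cdom_mem.
Qed.

Lemma coord_field0 p q : coord_field p 0 q = 0.
Proof. exact: derive0. Qed.

Lemma coord_field_id p v : coord_field p v p = v.
Proof.
rewrite /coord_field -[RHS](derive_id (chart p p)); apply: near_eq_derive.
apply: filterS (near_cinv (cdom_mem p) (near_cdom (cdom_mem p))) => x [px _] /=.
exact: cinvK.
Qed.

(** The differentials of the two transition maps are inverse to each other at [q]. For a smooth
    field this gives smooth coefficients in a frame of coordinate fields. *)
Lemma vf_expand p q v : cdom p q ->
  v = \sum_(k < m) dirder q v (fun r => chart p r 0 k) *:
        coord_field p (delta_mx 0 k) q.
Proof.
move=> pq; have qq := cdom_mem q.
have dqp := transition_differentiable qq pq.
have dpq := transition_differentiable pq qq.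
transitivity (coord_field p ('D_v (chart p \o cinv q) (chart q q)) q).
  have dq : differentiable (chart q \o cinv p) ((chart p \o cinv q) (chart q q)).
    by rewrite /= chartK.
  have := derive_comp v dqp dq.
  rewrite /= chartK // -/(coord_field p _ q) => <-.
  rewrite -[LHS](derive_id (chart q q)); apply: near_eq_derive.
  apply: filterS (near_cinv qq (near_cdom pq)) => x [qx px] /=.
  by rewrite chartK // cinvK.
rewrite {1}['D_v _ _]row_sum_delta /coord_field derive_sum_dir //.
apply: eq_bigr => k _; congr (_ *: _).
by rewrite derive_row.
Qed.

End ManifoldCalculus.

(** * Connections *)

Lemma linear_lincomb (R : realType) (V W : lmodType R) (L : V -> W) n
    (c : 'I_n -> R) (v : 'I_n -> V) :
  (forall a x y, L (a *: x + y) = a *: L x + L y) ->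
  L (\sum_i c i *: v i) = \sum_i c i *: L (v i).
Proof.
move=> hL.
have L0 : L 0 = 0.
  have := hL 1 0 0; rewrite !scale1r addr0 => /esym/eqP.
  by rewrite -subr_eq0 addrK => /eqP.
elim: n c v => [|n IH] c v; first by rewrite !big_ord0.
by rewrite !big_ord_recl hL IH.
Qed.

Lemma scaler_subD (R : realType) (V : lmodType R) (a : R) (u v u' v' : V) :
  (a *: u + v) - (a *: u' + v') = a *: (u - u') + (v - v').
Proof. by rewrite scalerBr opprD addrACA. Qed.

Section Connections.
Variables (R : realType) (m : nat) (M : manifold R m).
Implicit Types (p q : M) (v w x y z : 'rV[R]_m) (phi psi : M -> R)
  (X Y Z : M -> 'rV[R]_m) (D : connection M)
  (g : M -> 'rV[R]_m -> 'rV[R]_m -> R)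
  (om : M -> 'rV[R]_m -> 'rV[R]_m -> 'rV[R]_m).

(** Expanding both fields in the coordinate frame reduces smoothness to the finitely many
    coefficients of [g], so only coordinate fields need to be checked. *)
Lemma form_smooth g p X Y : bilinear_form g ->
  (forall v w, fun_smooth_at
    (fun q => g q (coord_field p v q) (coord_field p w q)) p) ->
  vf_smooth_at X p -> vf_smooth_at Y p ->
  fun_smooth_at (fun q => g q (X q) (Y q)) p.
Proof.
move=> bg sg sX sY; have pp := cdom_mem p.
pose xi Z k q := dirder q (Z q) (fun r => chart p r 0 k).
have sxi Z k : vf_smooth_at Z p -> fun_smooth_at (xi Z k) p.
  by move=> sZ; apply: sZ; exact: chart_coord_smooth.
pose c k := coord_field p (delta_mx 0 k).
apply: (@fun_smooth_eq _ _ _ _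
    (fun q => \sum_i xi X i q * (\sum_j xi Y j q * g q (c i q) (c j q)))).
  apply: filterS (near_cdom pp) => q pq.
  rewrite [in RHS](vf_expand (X q) pq) [in RHS](vf_expand (Y q) pq).
  rewrite [RHS](@linear_lincomb _ _ R^o (g q ^~ _)) => [|a x y]; last first.
    exact: (bg q).1.
  apply: eq_bigr => i _; congr (_ * _).
  rewrite [RHS](@linear_lincomb _ _ R^o (g q (c i q))) // => a x y.
  exact: (bg q).2.
apply: fun_smooth_sum => i; apply: fun_smoothM; first exact: sxi.
apply: fun_smooth_sum => j; apply: fun_smoothM; first exact: sxi.
exact: sg.
Qed.

Lemma tensor21_smooth om p X Y :
  (forall q a x y z, om q (a *: x + y) z = a *: om q x z + om q y z) ->
  (forall q a x y z, om q z (a *: x + y) = a *: om q z x + om q z y) ->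
  (forall v w, vf_smooth_at
    (fun q => om q (coord_field p v q) (coord_field p w q)) p) ->
  vf_smooth_at X p -> vf_smooth_at Y p ->
  vf_smooth_at (fun q => om q (X q) (Y q)) p.
Proof.
move=> oml omr som sX sY; have pp := cdom_mem p.
pose xi Z k q := dirder q (Z q) (fun r => chart p r 0 k).
have sxi Z k : vf_smooth_at Z p -> fun_smooth_at (xi Z k) p.
  by move=> sZ; apply: sZ; exact: chart_coord_smooth.
pose c k := coord_field p (delta_mx 0 k).
apply: (@vf_smooth_eq _ _ _ _
    (fun q => \sum_i xi X i q *: (\sum_j xi Y j q *: om q (c i q) (c j q)))).
  apply: filterS (near_cdom pp) => q pq.
  rewrite [in RHS](vf_expand (X q) pq) [in RHS](vf_expand (Y q) pq).
  rewrite [RHS](@linear_lincomb _ _ _ (om q ^~ _)) => [|a x y]; last first.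
    exact: oml.
  apply: eq_bigr => i _; congr (_ *: _).
  rewrite [RHS](@linear_lincomb _ _ _ (om q (c i q))) //.
apply: vf_smooth_sum => i; apply: vf_smoothZ; first exact: sxi.
apply: vf_smooth_sum => j; apply: vf_smoothZ; first exact: sxi.
exact: som.
Qed.

(** Near [p] a coordinate field acts on the coordinates of the chart at [p] by constants, and the
    bracket differentiates these constants once more. *)
Lemma lie_coord_field p x y : lie (coord_field p x) (coord_field p y) p = 0.
Proof.
have pp := cdom_mem p.
have E w k : \forall q \near p,
    dirder q (coord_field p w q) (fun r => chart p r 0 k) = w 0 k.
  apply: filterS (near_cdom pp) => q pq.
  rewrite dirder_coord_field //; last exact: chart_coord_smooth.
  rewrite -[RHS](derive_coord (chart p q)); apply: near_eq_derive.
  by apply: filterS (near_cinv pq (near_cdom pq)) => r [pr _] /=; rewrite cinvK.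
apply/rowP => k; rewrite !mxE /= (dirder_eq _ (E y k)) (dirder_eq _ (E x k)).
by rewrite !dirder_cst subrr.
Qed.

Local Opaque coord_field dirder.

Lemma conn_add_is_connection D om : is_connection D -> tensor21 om ->
  is_connection (conn_add D om).
Proof.
move=> [Dl Da DL De Ds] [ol or os]; split; rewrite /conn_add.
- by move=> p a v w Y sY; rewrite Dl // ol scalerDr addrACA.
- move=> p v Y Z sY sZ; rewrite Da //.
  by have := or p 1 (Y p) (Z p) v; rewrite !scale1r => ->; rewrite addrACA.
- move=> p v phi Y sphi sY; rewrite DL // scalerDr addrA; congr (_ + _).
  have z0 : om p v 0 = 0.
    have := or p 1 0 0 v; rewrite !scale1r addr0 => /esym/eqP.
    by rewrite -subr_eq0 addrK => /eqP.
  by have := or p (phi p) (Y p) 0 v; rewrite z0 !addr0.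
- by move=> p v Y Z sY YZ; rewrite (De _ _ _ _ sY YZ) (nbhs_singleton YZ).
- by move=> p X Y sX sY; apply: vf_smoothD; [exact: Ds|exact: os].
Qed.

Section OneConnection.
Variable D : connection M.
Hypothesis hD : is_connection D.

Lemma conn_linl p a v w Y : vf_smooth_at Y p ->
  D p (a *: v + w) Y = a *: D p v Y + D p w Y.
Proof. by case: hD => Dl _ _ _ _; exact: Dl. Qed.

Lemma conn_leibniz p v phi Y : fun_smooth_at phi p -> vf_smooth_at Y p ->
  D p v (fun q => phi q *: Y q) = dirder p v phi *: Y p + phi p *: D p v Y.
Proof. by case: hD => _ _ DL _ _; exact: DL. Qed.

Lemma conn_addf p v Y Z : vf_smooth_at Y p -> vf_smooth_at Z p ->
  D p v (fun q => Y q + Z q) = D p v Y + D p v Z.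
Proof. by case: hD => _ Da _ _ _; exact: Da. Qed.

Lemma conn_local p v Y Z : vf_smooth_at Y p -> (\forall q \near p, Y q = Z q) ->
  D p v Y = D p v Z.
Proof. by case: hD => _ _ _ De _; exact: De. Qed.

Lemma conn_smooth p X Y : vf_smooth_at X p -> vf_smooth_at Y p ->
  vf_smooth_at (fun q => D q (X q) Y) p.
Proof. by case: hD => _ _ _ _ Ds; exact: Ds. Qed.

Lemma conn0l p Y : vf_smooth_at Y p -> D p 0 Y = 0.
Proof.
move=> sY; have := conn_linl 1 0 0 sY; rewrite !scale1r addr0 => /esym/eqP.
by rewrite -subr_eq0 addrK => /eqP.
Qed.

Lemma conn_linr p v a Y Z : vf_smooth_at Y p -> vf_smooth_at Z p ->
  D p v (fun q => a *: Y q + Z q) = a *: D p v Y + D p v Z.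
Proof.
move=> sY sZ; have sa := fun_smooth_cst p a.
rewrite (conn_addf _ (vf_smoothZ sa sY) sZ).
by rewrite (conn_leibniz _ sa) // dirder_cst scale0r add0r.
Qed.

Lemma conn0r p v : D p v (fun=> 0) = 0.
Proof.
have s0 := @vf_smooth0 _ _ M p.
have := conn_linr v 1 s0 s0; under eq_fun do rewrite scale1r addr0.
by rewrite scale1r => /esym/eqP; rewrite -subr_eq0 addrK => /eqP.
Qed.

Lemma curvE p x y z : curv D p x y z =
  D p x (fun q => D q (coord_field p y q) (coord_field p z)) -
  D p y (fun q => D q (coord_field p x q) (coord_field p z)).
Proof.
rewrite /curv /curvature lie_coord_field conn0l ?subr0 ?coord_field_id //.
exact/coord_field_smooth/cdom_mem.
Qed.

Lemma conn_coord_smooth p y z :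
  vf_smooth_at (fun q => D q (coord_field p y q) (coord_field p z)) p.
Proof. by apply: conn_smooth; exact/coord_field_smooth/cdom_mem. Qed.

(** Linearity in the second and third slot is what makes the Ricci sum the trace of a bilinear form.
    Coordinate fields are linear in the vector only on [cdom p], hence the detour through
    locality. *)
Lemma curv_linear2 p x a y y' z :
  curv D p x (a *: y + y') z = a *: curv D p x y z + curv D p x y' z.
Proof.
have sc v : vf_smooth_at (coord_field p v) p.
  exact/coord_field_smooth/cdom_mem.
rewrite !curvE conn_linl; last exact: conn_coord_smooth.
have E : \forall q \near p,
    D q (coord_field p (a *: y + y') q) (coord_field p z) =
    a *: D q (coord_field p y q) (coord_field p z) +
    D q (coord_field p y' q) (coord_field p z).
  apply: filterS (near_cdom (cdom_mem p)) => q pq.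
  by rewrite coord_field_linear // conn_linl //; exact: coord_field_smooth.
rewrite (conn_local x (@conn_coord_smooth p (a *: y + y') z) E).
rewrite conn_linr; [|exact: conn_coord_smooth..].
exact: scaler_subD.
Qed.

Lemma curv_linear3 p x y a z z' :
  curv D p x y (a *: z + z') = a *: curv D p x y z + curv D p x y z'.
Proof.
have E w : \forall q \near p,
    D q (coord_field p w q) (coord_field p (a *: z + z')) =
    a *: D q (coord_field p w q) (coord_field p z) +
    D q (coord_field p w q) (coord_field p z').
  apply: filterS (near_cdom (cdom_mem p)) => q pq.
  rewrite -conn_linr; [|exact: coord_field_smooth..].
  apply: conn_local; first exact: coord_field_smooth.
  by apply: filterS (near_cdom pq) => r pr; rewrite coord_field_linear.
rewrite !curvE (conn_local x (@conn_coord_smooth p y (a *: z + z')) (E _)).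
rewrite (conn_local y (@conn_coord_smooth p x (a *: z + z')) (E _)).
rewrite !conn_linr; [|exact: conn_coord_smooth..].
exact: scaler_subD.
Qed.

End OneConnection.

(* The difference of two torsion-free metric connections is symmetric in its
   first two slots and skew in its last two, hence zero. *)
Lemma levi_civita_unique g D1 D2 p v Y :
  bilinear_form g -> (forall x y, g p x y = g p y x) ->
  (forall x, (forall y, g p x y = 0) -> x = 0) ->
  (forall D, D = D1 \/ D = D2 ->
    (forall w X Z, vf_smooth_at X p -> vf_smooth_at Z p ->
      dirder p w (fun q => g q (X q) (Z q)) =
        g p (D p w X) (Z p) + g p (X p) (D p w Z)) /\
    (forall X Z, vf_smooth_at X p -> vf_smooth_at Z p ->
      torsion D X Z p = 0)) ->
  vf_smooth_at Y p -> D1 p v Y = D2 p v Y.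
Proof.
move=> bg gC nd H sY.
have [met1 tor1] := H D1 (or_introl erefl).
have [met2 tor2] := H D2 (or_intror erefl).
have sc w : vf_smooth_at (coord_field p w) p.
  exact/coord_field_smooth/cdom_mem.
have gB a b c : g p (a - b) c = g p a c - g p b c.
  by rewrite addrC -scaleN1r (bg p).1 mulN1r addrC.
pose s X Z W := g p (D1 p (X p) Z - D2 p (X p) Z) (W p).
have sym X Z W : vf_smooth_at X p -> vf_smooth_at Z p -> s X Z W = s Z X W.
  move=> sX sZ; congr (g p _ _); apply/eqP; rewrite -subr_eq0.
  (* The bracket is the same for both connections, so the antisymmetrised difference is a difference
     of torsions. *)
  rewrite [X in X == 0](_ : _ = torsion D1 X Z p - torsion D2 X Z p).
    by rewrite tor1 // tor2 // subrr.
  by apply/rowP => i; rewrite !mxE; ring.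
have aux (a1 a2 b1 b2 : R) : a2 + b2 = a1 + b1 -> a1 - a2 = - (b1 - b2).
  by move=> ?; lra.
have skew X Z W : vf_smooth_at X p -> vf_smooth_at Z p -> vf_smooth_at W p ->
    s X Z W = - s X W Z.
  move=> sX sZ sW; rewrite /s !gB.
  have := met1 (X p) Z W sZ sW; rewrite (met2 (X p) Z W sZ sW).
  by rewrite (gC (Z p)) (gC (Z p)); exact: aux.
apply/eqP; rewrite -subr_eq0; apply/eqP/nd => w.
(* Vanishing torsion is a statement on fields, so the vectors [v] and [w] are extended by coordinate
   fields. *)
have := sc v; set X := coord_field p v => sX.
have := sc w; set W := coord_field p w => sW.
have : s X Y W = 0.
  have : s X Y W = - s X Y W.
    rewrite [LHS]skew // [s X W Y]sym // [s W X Y]skew // opprK.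
    by rewrite [s W Y X]sym // [s Y W X]skew // [s Y X W]sym.
  by move/eqP; rewrite -addr_eq0 -mulr2n mulrn_eq0 /= => /eqP.
by rewrite /s /X /W !coord_field_id.
Qed.

End Connections.

(** * The product of the line with F *)

Section RowBlocks.
Variable R : realType.

Lemma row_mx_lin n1 n2 (a : R) (u u' : 'rV[R]_n1) (v v' : 'rV[R]_n2) :
  row_mx (a *: u + u') (a *: v + v') = a *: row_mx u v + row_mx u' v'.
Proof. by rewrite scale_row_mx add_row_mx. Qed.

Lemma derive_row_mx (V : normedModType R) n1 n2 (f : V -> 'rV[R]_n1)
    (g : V -> 'rV[R]_n2) x v : differentiable f x -> differentiable g x ->
  'D_v (fun y => row_mx (f y) (g y)) x = row_mx ('D_v f x) ('D_v g x).
Proof.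
move=> df dg.
have dfg : differentiable (fun y => row_mx (f y) (g y)) x.
  apply: differentiable_row => i; case: (split_ordP i) => j ->{i}.
    under eq_fun do rewrite row_mxEl.
    exact: (differentiable_comp df (differentiable_coord _ _ _)).
  under eq_fun do rewrite row_mxEr.
  exact: (differentiable_comp dg (differentiable_coord _ _ _)).
apply/rowP => i; rewrite derive_row //; case: (split_ordP i) => j ->{i}.
  by rewrite row_mxEl derive_row //; under eq_fun do rewrite row_mxEl.
by rewrite row_mxEr derive_row //; under eq_fun do rewrite row_mxEr.
Qed.

End RowBlocks.

(** * The projections, coordinate fields and tensors in product charts *)

Section LineProductFormulas.
Variables (R : realType) (m : nat) (F : manifold R m).
Local Notation M := (line_product F).
Implicit Types (z : M) (x y v : 'rV[R]_(1 + m)) (w : 'rV[R]_m).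

(** Rows at different points refer to different charts, but t is the first coordinate in all of
    them; one constant row therefore represents d/dt everywhere. *)
Definition unit_t : 'rV[R]_(1 + m) := row_mx 1%:M 0.
Definition incF w : 'rV[R]_(1 + m) := row_mx 0 w.
Definition tpart x : R := x 0 (lshift m 0).

Lemma tpart_linear a x y : tpart (a *: x + y) = a * tpart x + tpart y.
Proof. by rewrite /tpart !mxE. Qed.

Lemma incF_linear a w w' : incF (a *: w + w') = a *: incF w + incF w'.
Proof. by rewrite /incF -row_mx_lin scaler0 addr0. Qed.

Lemma tpart0 : tpart 0 = 0.
Proof. by rewrite /tpart mxE. Qed.

Lemma tpart_unit : tpart unit_t = 1.
Proof. by rewrite /tpart row_mxEl mxE eqxx. Qed.

Lemma tpart_incF w : tpart (incF w) = 0.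
Proof. by rewrite /tpart row_mxEl mxE. Qed.

Lemma rsub_unit : rsubmx unit_t = 0 :> 'rV[R]_m.
Proof. exact: row_mxKr. Qed.

Lemma rsub_incF w : rsubmx (incF w) = w.
Proof. exact: row_mxKr. Qed.

Lemma split_tF x : x = tpart x *: unit_t + incF (rsubmx x).
Proof.
rewrite /unit_t /incF scale_row_mx add_row_mx scaler0 addr0 add0r.
rewrite -[LHS]hsubmxK; congr row_mx; apply/rowP => i.
by rewrite !mxE !ord1 eqxx mulr1.
Qed.

(** In product charts the projection to F is the linear map [rsubmx], so both sides are limits of
    the same difference quotient. *)
Lemma dirder_projF z x (psi : F -> R) :
  dirder z x (psi \o @projF R m F) = dirder (projF z) (rsubmx x) psi.
Proof.
rewrite /dirder /derive /=.
by under eq_fun do rewrite linearP /= /line_chart !row_mxKr.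
Qed.

Lemma dtE z x : dt z x = tpart x.
Proof.
rewrite /dt /dirder (_ : _ \o _ = fun y => y 0 (lshift m 0)).
  exact: derive_coord.
by apply/funext => y /=; rewrite /tcoord /= mxE.
Qed.

Lemma dprojFE z x : dprojF z x = rsubmx x.
Proof.
rewrite -[RHS](coord_field_id (projF z)) /coord_field /dprojF /mdiff.
rewrite /derive /=.
by under eq_fun do rewrite linearP /= /line_chart !row_mxKr.
Qed.

Lemma tangentFE z w : tangentF z w = incF w.
Proof.
have zz := cdom_mem (projF z).
have -> : tangentF z w = 'D_w (fun r => row_mx (tcoord z)%:M
    ((chart (projF z) \o cinv (projF z)) r)) (chart (projF z) (projF z)) by [].
rewrite derive_row_mx; last 2 first.
- exact: differentiable_cst.
- exact: transition_differentiable.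
rewrite derive_cst; congr row_mx.
exact: (coord_field_id (projF z) w).
Qed.

Lemma derive_scalar1 (t v : R) :
  differentiable (fun s : R => s%:M : 'rV[R]_1) t /\
  'D_v (fun s : R => s%:M : 'rV[R]_1) t = v%:M.
Proof.
have E j : (fun s : R => (s%:M : 'rV[R]_1) 0 j) = id.
  by apply/funext => s; rewrite mxE ord1 eqxx mulr1n.
have dd : differentiable (fun s : R => s%:M : 'rV[R]_1) t.
  apply: differentiable_row => j; rewrite E.
  by have [] := is_diff_id t.
split=> //; apply/rowP => j.
by rewrite derive_row // E derive_id mxE ord1 eqxx mulr1n.
Qed.

Lemma partial_tE z : partial_t z = unit_t.
Proof.
have -> : partial_t z = derive1 (fun s : R =>
    row_mx s%:M (chart (projF z) (projF z))) (tcoord z) by [].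
rewrite derive1E derive_row_mx; last 2 first.
- exact: (derive_scalar1 _ 1).1.
- exact: differentiable_cst.
by rewrite (derive_scalar1 _ 1).2 derive_cst.
Qed.

(** A transition map between product charts is the identity in t times a transition map of F, so its
    derivative splits into blocks. *)
Lemma coord_field_lineE (p z : M) x : cdom (projF p) (projF z) ->
  coord_field p x z = row_mx (lsubmx x) (coord_field (projF p) (rsubmx x) (projF z)).
Proof.
move=> pz; have zz := cdom_mem (projF z).
have pzM : cdom p z by [].
have zzM := cdom_mem z.
have dT := transition_differentiable pzM zzM.
have dF := transition_differentiable pz zz.
apply/rowP => i; rewrite derive_row //; case: (split_ordP i) => j ->{i}.
  have E : (fun y => (chart z \o cinv p) y 0 (lshift m j)) =
      (fun y => y 0 (lshift m j)).
    apply/funext => y /=.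
    by rewrite /line_chart row_mxEl (ord1 j) mxE eqxx mulr1n /= mxE.
  by rewrite row_mxEl mxE E derive_coord.
rewrite row_mxEr /coord_field derive_row //.
rewrite /derive /=.
by under eq_fun do
  rewrite /line_chart !row_mxEr /line_cinv /= linearP /= !row_mxKr.
Qed.

Local Opaque coord_field.

Lemma coord_field_unit (p z : M) : cdom (projF p) (projF z) ->
  coord_field p unit_t z = unit_t.
Proof.
move=> pz; rewrite (coord_field_lineE _ pz) rsub_unit coord_field0.
by rewrite /unit_t row_mxKl.
Qed.

Lemma coord_field_incF (p z : M) w : cdom (projF p) (projF z) ->
  coord_field p (incF w) z = incF (coord_field (projF p) w (projF z)).
Proof.
by move=> pz; rewrite (coord_field_lineE _ pz) rsub_incF /incF row_mxKl.
Qed.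

Lemma tpart_coord_field (p z : M) x : cdom (projF p) (projF z) ->
  tpart (coord_field p x z) = tpart x.
Proof. by move=> pz; rewrite (coord_field_lineE _ pz) /tpart row_mxEl mxE. Qed.

Lemma rsub_coord_field (p z : M) x : cdom (projF p) (projF z) ->
  rsubmx (coord_field p x z) = coord_field (projF p) (rsubmx x) (projF z).
Proof. by move=> pz; rewrite (coord_field_lineE _ pz) row_mxKr. Qed.

Lemma projF_smooth z (psi : F -> R) : fun_smooth_at psi (projF z) ->
  fun_smooth_at (psi \o @projF R m F) z.
Proof.
move=> [W [oW Wz] sW]; exists (rsubmx @^-1` W).
  split; last by rewrite /= /line_chart row_mxKr.
  by apply: open_comp => // x _; exact: continuous_rsubmx.
apply: (@smooth_on_comp_lin _ _ _ (@rsubmx R 1 1 m)) sW.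
exact: continuous_rsubmx.
Qed.

Lemma tcoord_smooth z : fun_smooth_at (@tcoord R m F) z.
Proof.
exists setT; first by split => //; exact: openT.
rewrite (_ : _ \o _ = fun y => y 0 (lshift m 0)); first exact: smooth_coord.
by apply/funext => y /=; rewrite /tcoord /= mxE.
Qed.

(** Each directional derivative raises the order [i] by one and multiplies by a component of the
    direction; carrying [i] and [c] makes the induction close. *)
Lemma Ck_tcoord k (phi : R -> R) (U : set 'rV[R]_(1 + m)) i c : smoothR phi ->
  Ck k U (fun x => c * derive1n i phi (x 0 (lshift m 0))).
Proof.
move=> sphi; have dd j t : differentiable (derive1n j phi) t.
  exact/derivable1_diffP/sphi.
have dx j a x : differentiable
    (fun x : 'rV[R]_(1 + m) => a * derive1n j phi (x 0 (lshift m 0))) x.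
  apply: differentiableZ.
  exact: (differentiable_comp (differentiable_coord _ _ _) (dd _ _)).
elim: k i c => [|k IH] i c /=.
  by move=> x _; apply: differentiable_continuous; exact: dx.
split=> [x _|v]; first exact: dx.
rewrite (_ : 'D_v _ = fun x => (c * v 0 (lshift m 0)) *
    derive1n i.+1 phi (x 0 (lshift m 0))); first exact: IH.
apply/funext => x.
rewrite (@deriveZ _ _ _ (derive1n i phi \o (fun x : 'rV[R]_(1 + m) => x 0 (lshift m 0)))).
  rewrite derive_comp; [|exact: differentiable_coord|exact: dd].
  rewrite derive_coord derive1nS derive1E -[v 0 _ in LHS]mulr1.
  by rewrite deriveE // linearZ -deriveE // /GRing.scale /= mulrA.
apply: diff_derivable.
exact: (differentiable_comp (differentiable_coord _ _ _) (dd _ _)).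
Qed.

Lemma smooth_of_tcoord z (phi : R -> R) : smoothR phi ->
  fun_smooth_at (fun q : M => phi (tcoord q)) z.
Proof.
move=> sphi; exists setT; first by split => //; exact: openT.
move=> k; have := @Ck_tcoord k phi setT 0 1 sphi.
rewrite (_ : _ \o _ = (fun x => 1 * derive1n 0 phi (x 0 (lshift m 0)))) //.
by apply/funext => y /=; rewrite /tcoord /= mul1r mxE.
Qed.

Lemma dirder_tcoord z x (phi : R -> R) : derivable phi (tcoord z) 1 ->
  dirder z x (fun q : M => phi (tcoord q)) = tpart x * derive1 phi (tcoord z).
Proof.
move=> /derivable1_diffP dphi.
have Ez : (chart z z) 0 (lshift m 0) = tcoord z.
  by rewrite /= /line_chart row_mxEl mxE eqxx.
rewrite /dirder (_ : _ \o _ = phi \o (fun y => y 0 (lshift m 0))); last first.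
  by apply/funext => y /=; rewrite /tcoord /= mxE.
rewrite derive_comp; [|exact: differentiable_coord|by rewrite Ez].
rewrite derive_coord Ez derive1E -[x 0 _ in LHS]mulr1.
by rewrite deriveE // linearZ -deriveE.
Qed.

Local Opaque dirder line_product.

(** Test functions on the product also depend on t, so smoothness of [W] cannot be applied to them
    directly. The lift is expanded in lifted coordinate fields, with coefficients pulled back from
    F. *)
Lemma lift_smooth z (W : F -> 'rV[R]_m) : vf_smooth_at W (projF z) ->
  vf_smooth_at (fun q : M => incF (W (projF q))) z.
Proof.
move=> sW; have zz := cdom_mem (projF z).
pose xi k q := dirder q (W q) (fun r => chart (projF z) r 0 k).
apply: (@vf_smooth_eq _ _ _ _ (fun q : M => \sum_k xi k (projF q) *:
    coord_field z (incF (delta_mx 0 k)) q)).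
  apply: filterS (near_cdom (cdom_mem z)) => q zq.
  rewrite [in RHS](vf_expand (W (projF q)) zq).
  rewrite linear_lincomb; last exact: incF_linear.
  by apply: eq_bigr => k _; rewrite coord_field_incF.
apply: vf_smooth_sum => k; apply: vf_smoothZ.
  by apply: projF_smooth; apply: sW; exact: chart_coord_smooth.
exact/coord_field_smooth/cdom_mem.
Qed.

Lemma unit_t_smooth z : vf_smooth_at (fun _ : M => unit_t) z.
Proof.
apply: (@vf_smooth_eq _ _ _ _ (coord_field z unit_t)).
  by apply: filterS (near_cdom (cdom_mem z)) => q zq; rewrite coord_field_unit.
exact/coord_field_smooth/cdom_mem.
Qed.

Lemma tpart_smooth z (X : M -> 'rV[R]_(1 + m)) : vf_smooth_at X z ->
  fun_smooth_at (fun q => tpart (X q)) z.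
Proof.
move=> /(_ _ (tcoord_smooth z)); congr fun_smooth_at.
by apply/funext => q; rewrite -(dtE q).
Qed.

(** This is pi^* g_F, degenerate along d/dt; both metrics are [eps] dt^2 plus a multiple of it that
    depends on t alone. *)
Definition formF (gF : F -> 'rV[R]_m -> 'rV[R]_m -> R) z x y : R :=
  gF (projF z) (rsubmx x) (rsubmx y).

Lemma formF_smooth gF z (X Y : M -> 'rV[R]_(1 + m)) : riemannian gF ->
  vf_smooth_at X z -> vf_smooth_at Y z ->
  fun_smooth_at (fun q => formF gF q (X q) (Y q)) z.
Proof.
move=> [bg _ _ sg]; apply: form_smooth.
  by move=> p; split=> a x y v; rewrite /formF linearP; [exact: (bg _).1|exact: (bg _).2].
move=> v w.
apply: (@fun_smooth_eq _ _ _ _ ((fun q => gF q (coord_field (projF z) (rsubmx v) q)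
   (coord_field (projF z) (rsubmx w) q)) \o @projF R m F)).
  apply: filterS (near_cdom (cdom_mem z)) => q zq.
  rewrite /formF (rsub_coord_field v zq).
  rewrite (rsub_coord_field w zq).
  reflexivity.
by apply: projF_smooth; apply: sg; exact/coord_field_smooth/cdom_mem.
Qed.

Lemma pullbackE om z x y :
  pullback om z x y = incF (om (projF z) (rsubmx x) (rsubmx y)).
Proof. by rewrite /pullback tangentFE !dprojFE. Qed.

Lemma pullback_tensor21 om : tensor21 om -> tensor21 (@pullback R m F om).
Proof.
move=> [ol or os].
have pl q a x y v : pullback om q (a *: x + y) v =
    a *: pullback om q x v + pullback om q y v.
  by rewrite !pullbackE linearP ol incF_linear.
have pr q a x y v : pullback om q v (a *: x + y) =
    a *: pullback om q v x + pullback om q v y.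
  by rewrite !pullbackE linearP or incF_linear.
split; [exact: pl|exact: pr|move=> p X Y].
apply: (tensor21_smooth pl pr) => v w.
apply: (@vf_smooth_eq _ _ _ _ (fun q : M => incF ((fun r => om r
   (coord_field (projF p) (rsubmx v) r)
   (coord_field (projF p) (rsubmx w) r)) (projF q)))).
  apply: filterS (near_cdom (cdom_mem p)) => q pq.
  rewrite pullbackE.
  rewrite (rsub_coord_field v pq) (rsub_coord_field w pq).
  reflexivity.
apply: (@lift_smooth p (fun r => om r _ _)).
by apply: os; exact/coord_field_smooth/cdom_mem.
Qed.

End LineProductFormulas.
Arguments unit_t {R m}.

(** * Orthonormal bases and traces *)

Section OrthonormalBases.
Variable R : realType.

(** With n < m orthonormal rows [e], the matrix G e^T has rank at most n, so its left kernel
    contains a nonzero vector; normalised, it is the next row. *)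
Lemma gram_schmidt m n (G : 'M[R]_m) : G^T = G ->
  (forall x : 'rV[R]_m, x != 0 -> 0 < (x *m G *m x^T) 0 0) -> (n <= m)%N ->
  exists e : 'M[R]_(n, m), e *m G *m e^T = 1%:M.
Proof.
move=> sG pG; elim: n => [_|n IH nm].
  by exists 0; apply/matrixP => -[].
have [e eG] := IH (ltnW nm).
pose K := kermx (G *m e^T).
have K0 : K != 0.
  rewrite -mxrank_eq0 mxrank_ker subn_eq0 -ltnNge.
  exact: leq_ltn_trans (rank_leq_col _) nm.
have [i vi] : exists i, row i K != 0.
  apply/existsP; rewrite -[X in is_true X]negbK negb_exists; apply/negP => /forallP K00.
  move/eqP: K0; apply; apply/row_matrixP => i; rewrite row0.
  by apply/eqP; rewrite -[_ == _]negbK.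
pose v := row i K.
have vGe : v *m G *m e^T = 0.
  by rewrite -mulmxA /v -row_mul mulmx_ker row0.
have v0 : 0 < (v *m G *m v^T) 0 0 by exact: pG.
pose c := Num.sqrt ((v *m G *m v^T) 0 0).
have c0 : c != 0 by rewrite gt_eqF // sqrtr_gt0.
pose w := c^-1 *: v.
have wGe : w *m G *m e^T = 0 by rewrite /w -!scalemxAl vGe scaler0.
have eGw : e *m G *m w^T = 0.
  by apply: trmx_inj; rewrite trmx0 !trmx_mul trmxK sG mulmxA wGe.
have wGw : w *m G *m w^T = 1%:M.
  rewrite /w linearZ /= -scalemxAr -!scalemxAl [v *m _ *m _]mx11_scalar.
  rewrite !scale_scalar_mx mulrA -invfM -expr2 sqr_sqrtr ?ltW // mulVf //.
  by rewrite gt_eqF.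
exists (castmx (addn1 n, erefl m) (col_mx e w)).
case: _ / (addn1 n); rewrite castmx_id mul_col_mx tr_col_mx mul_col_row.
by rewrite eG wGe eGw wGw -scalar_mx_block.
Qed.

Definition form_mx m (b : 'rV[R]_m -> 'rV[R]_m -> R) : 'M[R]_m :=
  \matrix_(i, j) b (delta_mx 0 i) (delta_mx 0 j).

Section Form.
Variables (m : nat) (b : 'rV[R]_m -> 'rV[R]_m -> R).
Hypothesis bl : forall a x y z, b (a *: x + y) z = a * b x z + b y z.
Hypothesis br : forall a x y z, b z (a *: x + y) = a * b z x + b z y.

Lemma form_mxE x y : b x y = (x *m form_mx b *m y^T) 0 0.
Proof.
rewrite {1}[x]row_sum_delta (@linear_lincomb _ _ R^o (b ^~ y)) //.
rewrite -mulmxA mxE; apply: eq_bigr => i _; congr (_ * _).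
rewrite {1}[y]row_sum_delta (@linear_lincomb _ _ R^o (b _)) //.
rewrite mxE; apply: eq_bigr => j _; rewrite mxE mxE.
exact: mulrC.
Qed.

Lemma form_mx_rows n n' (e : 'M[R]_(n, m)) (e' : 'M[R]_(n', m)) i j :
  b (row i e) (row j e') = (e *m form_mx b *m e'^T) i j.
Proof.
rewrite form_mxE tr_row -row_mul [LHS]mxE [RHS]mxE.
by apply: eq_bigr => k _; congr (_ * _); rewrite mxE.
Qed.

End Form.

(** Let S be the diagonal matrix of signs. From e G e^T = S and S^2 = 1 follows G^-1 = e^T S e, and
    the trace is cyclic. The right side does not mention [e], so the basis chosen in [ricci] may be
    exchanged for any other one. *)
Lemma onb_trace m (g b : 'rV[R]_m -> 'rV[R]_m -> R) (e : 'M[R]_m) :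
  (forall a x y z, g (a *: x + y) z = a * g x z + g y z) ->
  (forall a x y z, g z (a *: x + y) = a * g z x + g z y) ->
  (forall a x y z, b (a *: x + y) z = a * b x z + b y z) ->
  (forall a x y z, b z (a *: x + y) = a * b z x + b z y) ->
  (forall i j, if i == j then g (row i e) (row i e) = 1 \/
                              g (row i e) (row i e) = -1
               else g (row i e) (row j e) = 0) ->
  \sum_i g (row i e) (row i e) * b (row i e) (row i e) =
    \tr (invmx (form_mx g) *m form_mx b).
Proof.
move=> gl gr bl br ong; set G := form_mx g.
pose s i := g (row i e) (row i e).
pose S := diag_mx (\row_i s i).
have eGe : e *m G *m e^T = S.
  apply/matrixP => i j; rewrite -form_mx_rows // !mxE.
  by have := ong i j; case: eqP => [->|_ ->]; rewrite ?mulr1n ?mulr0n.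
have SS : S *m S = 1%:M.
  rewrite mulmx_diag -diag_const_mx; congr diag_mx; apply/rowP => i; rewrite !mxE.
  by have := ong i i; rewrite eqxx /s => -[] ->; rewrite ?mulr1 // mulrNN mulr1.
have inv1 : e *m (G *m e^T *m S) = 1%:M by rewrite !mulmxA eGe SS.
have inv2 : G *m (e^T *m S *m e) = 1%:M.
  by have := mulmx1C inv1; rewrite !mulmxA.
have [Gu _] := mulmx1_unit inv2.
have -> : invmx G = e^T *m S *m e.
  by have := mulKmx Gu (e^T *m S *m e); rewrite inv2 mulmx1.
rewrite -!mulmxA mxtrace_mulC -!mulmxA /mxtrace; apply: eq_bigr => i _.
rewrite mul_diag_mx mxE; congr (_ * _); first by rewrite mxE.
by rewrite form_mx_rows // mulmxA.
Qed.

End OrthonormalBases.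

(** * Product and warped product metrics *)

Section WarpedGeometry.
Variables (R : realType) (m : nat) (F : manifold R m).
Local Notation M := (line_product F).
Variable gF : F -> 'rV[R]_m -> 'rV[R]_m -> R.
Hypothesis hgF : riemannian gF.
Variable eps : R.
Hypothesis heps : eps = 1 \/ eps = -1.
Implicit Types (p q : M) (v x y z w : 'rV[R]_(1 + m))
  (X Y Z : M -> 'rV[R]_(1 + m)) (f : R -> R).
Local Notation G := (@formF R m F gF).
Local Notation Fp x := (incF (rsubmx (x : 'rV[R]_(1 + m)))).

Local Opaque coord_field dirder lie line_product.

Lemma eps_sqr : eps * eps = 1.
Proof. by case: heps => ->; rewrite ?mulr1 // mulrNN mulr1. Qed.

Lemma formF_linl p a x y z : G p (a *: x + y) z = a * G p x z + G p y z.
Proof. by case: hgF => bg _ _ _; rewrite /formF linearP; exact: (bg _).1. Qed.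

Lemma formF_linr p a x y z : G p z (a *: x + y) = a * G p z x + G p z y.
Proof. by case: hgF => bg _ _ _; rewrite /formF linearP; exact: (bg _).2. Qed.

Lemma formFC p x y : G p x y = G p y x.
Proof. by case: hgF => _ gC _ _; exact: gC. Qed.

Lemma formF0l p z : G p 0 z = 0.
Proof.
have := formF_linl p 1 0 0 z; rewrite scale1r addr0 mul1r => /esym/eqP.
by rewrite -subr_eq0 addrK => /eqP.
Qed.

Lemma formF_unitl p z : G p unit_t z = 0.
Proof. by rewrite -(formF0l p z) /formF rsub_unit linear0. Qed.

Lemma formF_unitr p z : G p z unit_t = 0.
Proof. by rewrite formFC formF_unitl. Qed.

Lemma formF_Fl p x z : G p (Fp x) z = G p x z.
Proof. by rewrite /formF rsub_incF. Qed.

Lemma formF_Fr p x z : G p z (Fp x) = G p z x.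
Proof. by rewrite /formF rsub_incF. Qed.

Lemma row_tF_eq x y : tpart x = tpart y -> rsubmx x = rsubmx y :> 'rV[R]_m -> x = y.
Proof. by move=> txy rxy; rewrite [x]split_tF [y]split_tF txy rxy. Qed.

Lemma warpedE f p x y : warped eps f gF p x y =
  eps * (tpart x * tpart y) + f (tcoord p) ^+ 2 * G p x y.
Proof. by rewrite /warped !dtE !dprojFE. Qed.

Lemma product_metric_warped : product_metric eps gF = warped eps (fun=> 1) gF.
Proof.
apply/funext => p; apply/funext => x; apply/funext => y.
by rewrite /product_metric /warped expr1n mul1r.
Qed.

Lemma warped_bilinear f : bilinear_form (warped eps f gF).
Proof.
move=> p; split=> a x y z; rewrite !warpedE tpart_linear.
  by rewrite formF_linl; ring.
by rewrite formF_linr; ring.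
Qed.

Lemma warpedC f p x y : warped eps f gF p x y = warped eps f gF p y x.
Proof. by rewrite !warpedE formFC (mulrC (tpart x)). Qed.

Lemma warped_unitr f p x : warped eps f gF p x unit_t = eps * tpart x.
Proof. by rewrite warpedE formF_unitr tpart_unit mulr1 mulr0 addr0. Qed.

Lemma warped_Fr f p x (w : 'rV[R]_m) : warped eps f gF p x (incF w) =
  f (tcoord p) ^+ 2 * G p x (incF w).
Proof. by rewrite warpedE tpart_incF !mulr0 add0r. Qed.

(** For [eps = -1] the metric is indefinite, so pairing [x] with itself says nothing. It is paired
    with d/dt, and then with its own F-part, where g_F is definite. *)
Lemma warped_nondegenerate f p x : f (tcoord p) != 0 ->
  (forall y, warped eps f gF p x y = 0) -> x = 0.
Proof.
move=> f0 gx.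
have tx : tpart x = 0.
  have := gx unit_t; rewrite warped_unitr => /(congr1 ( *%R eps)).
  by rewrite mulrA eps_sqr mul1r mulr0.
have rx : rsubmx x = 0 :> 'rV[R]_m.
  apply/eqP; rewrite -[_ == _]negbK; apply/negP => rx.
  have := gx (Fp x); rewrite warped_Fr formF_Fr => /eqP.
  rewrite mulf_eq0 expf_eq0 (negbTE f0) /= /formF.
  by case: hgF => _ _ pg _; rewrite gt_eqF // pg.
by apply: row_tF_eq; rewrite ?tx ?rx ?linear0 ?tpart0.
Qed.

(* The only properties of the connection of the product metric that the
   comparison of curvatures uses; adding the pullback of a totally
   skew-symmetric tensor preserves them. *)
Definition parallel_t (D : connection M) : Prop :=
  [/\ is_connection D,
      forall p v, D p v (fun=> unit_t) = 0,
      forall p v Y, vf_smooth_at Y p ->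
        dirder p v (fun q => tpart (Y q)) = tpart (D p v Y)
    & forall p v Y Z, vf_smooth_at Y p -> vf_smooth_at Z p ->
        dirder p v (fun q => G q (Y q) (Z q)) =
          G p (D p v Y) (Z p) + G p (Y p) (D p v Z)].

Lemma near_coord_unit p :
  \forall q \near p, coord_field p unit_t q = unit_t.
Proof.
by apply: filterS (near_cdom (cdom_mem p)) => q pq; exact: coord_field_unit.
Qed.

Lemma coord_smooth p v : vf_smooth_at (coord_field p v) p.
Proof. exact/coord_field_smooth/cdom_mem. Qed.
Arguments coord_smooth : clear implicits.

(** Coordinate fields commute, so vanishing torsion is symmetry of the Christoffel symbols. *)
Lemma torsion_free_coord (D : connection M) p x y :
  (forall X Y, vf_smooth_at X p -> vf_smooth_at Y p -> torsion D X Y p = 0) ->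
  D p x (coord_field p y) = D p y (coord_field p x).
Proof.
move=> /(_ _ _ (coord_smooth p x) (coord_smooth p y)).
rewrite /torsion lie_coord_field subr0 !coord_field_id => /eqP.
by rewrite subr_eq0 => /eqP.
Qed.

Lemma levi_civita_product_parallel (D : connection M) :
  levi_civita (product_metric eps gF) D -> parallel_t D.
Proof.
rewrite product_metric_warped => -[[hD metD] torD].
pose g := warped eps (fun=> 1) gF.
pose n p x y := D p x (coord_field p y).
have nC p x y : n p x y = n p y x.
  by apply: torsion_free_coord => X Y; exact: torD.
have met p v x y : dirder p v
    (fun q => g q (coord_field p x q) (coord_field p y q)) =
    g p (n p v x) y + g p x (n p v y).
  rewrite (metD _ _ _ _ (coord_smooth p x) (coord_smooth p y)).
  by rewrite !coord_field_id.
(* The product of d/dt with a coordinate field is the constant eps dt(z) near [p]. *)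
have A1 p v z : g p (n p v unit_t) z + g p unit_t (n p v z) = 0.
  rewrite -met (@dirder_eq _ _ _ _ _ _ (fun=> eps * tpart z)).
    exact: dirder_cst.
  apply: filterS (near_cdom (cdom_mem p)) => q pq.
  rewrite (coord_field_unit pq) /g warpedC warped_unitr.
  by rewrite (tpart_coord_field z pq).
(* The coefficients of the product metric are a constant plus a function on F, and d/dt annihilates
   both. *)
have A2 p x y : g p (n p unit_t x) y + g p x (n p unit_t y) = 0.
  pose c w := coord_field (projF p) (rsubmx (w : 'rV[R]_(1 + m))) : F -> 'rV[R]_m.
  rewrite -met (@dirder_eq _ _ _ _ _ _ (fun q : M => eps * (tpart x * tpart y) +
    ((fun r => gF r (c x r) (c y r)) \o @projF R m F) q)).
    have sF : fun_smooth_at (fun r => gF r (c x r) (c y r)) (projF p).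
      by case: hgF => _ _ _ sg; apply: sg;
        exact/coord_field_smooth/cdom_mem.
    rewrite dirderD; [|exact: fun_smooth_cst|exact: projF_smooth].
    by rewrite dirder_cst dirder_projF rsub_unit dirder0 addr0.
  apply: filterS (near_cdom (cdom_mem p)) => q pq.
  rewrite /g warpedE expr1n mul1r (tpart_coord_field x pq).
  rewrite (tpart_coord_field y pq) /formF.
  by rewrite (rsub_coord_field x pq) (rsub_coord_field y pq).
have gC p x y : g p x y = g p y x by exact: warpedC.
(* The bilinear form g(n(v, d/dt), z) is symmetric by A1 and skew by A2, since
   d/dt is a gradient and a Killing field. *)
have nt p v : n p v unit_t = 0.
  apply: (@warped_nondegenerate (fun=> 1) p) => [|z]; first exact: oner_neq0.
  rewrite -/(g _ _ _).
  have e1 := A1 p v z; have e2 := A1 p z v; have e3 := A2 p v z.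
  move: e1 e2 e3; rewrite (nC p z v) (nC p unit_t v) (nC p unit_t z).
  rewrite (gC p v (n p z unit_t)) .
  move: (g p (n p v unit_t) z) (g p (n p z unit_t) v) (g p unit_t _).
  by move=> a b c ? ? ?; lra.
have par p v : D p v (fun=> unit_t) = 0.
  by rewrite -[RHS](nt p v); apply/esym/(conn_local hD);
    [exact: coord_smooth|exact: near_coord_unit].
have tD p v Y : vf_smooth_at Y p ->
    dirder p v (fun q => tpart (Y q)) = tpart (D p v Y).
  move=> sY; have := metD p v _ _ sY (@unit_t_smooth _ _ _ p).
  rewrite par warped_unitr (_ : (fun q => _) = (fun q => eps * tpart (Y q))).
    rewrite (dirderZ _ _ (tpart_smooth sY)) warpedC warpedE formF0l.
    rewrite tpart0 mul0r !mulr0 !addr0 => /(congr1 ( *%R eps)).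
    by rewrite !mulrA eps_sqr !mul1r.
  by apply/funext => q; rewrite warped_unitr.
split=> // p v Y Z sY sZ.
(* Subtracting the Leibniz rule for the dt^2 part from the metric property leaves the metric
   property of pi^* g_F. *)
have := metD p v _ _ sY sZ; rewrite !warpedE expr1n !mul1r.
rewrite (_ : (fun q => _) = (fun q => eps * (tpart (Y q) * tpart (Z q)) +
    G q (Y q) (Z q))); last first.
  by apply/funext => q; rewrite warpedE expr1n mul1r.
have st := fun_smoothM (tpart_smooth sY) (tpart_smooth sZ).
rewrite dirderD; [|exact: fun_smoothM (fun_smooth_cst p eps) st
  |exact: formF_smooth].
rewrite (dirderZ _ _ st) (dirderM _ (tpart_smooth sY) (tpart_smooth sZ)).
rewrite (tD _ _ _ sY) (tD _ _ _ sZ).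
move: (tpart (D p v Y)) (tpart (D p v Z)) (tpart (Y p)) (tpart (Z p)).
move: (G p (D p v Y) (Z p)) (G p (Y p) (D p v Z)) (dirder _ _ _).
by move=> a b c d e i j E; apply: (addrI (eps * (i * e + j * d))); rewrite E; ring.
Qed.

End WarpedGeometry.
Arguments coord_smooth {R m F} p v.

(** * The Levi-Civita connection of the warped metric *)

Section WarpedConnection.
Variables (R : realType) (m : nat) (F : manifold R m).
Local Notation M := (line_product F).
Variable gF : F -> 'rV[R]_m -> 'rV[R]_m -> R.
Hypothesis hgF : riemannian gF.
Variable eps : R.
Hypothesis heps : eps = 1 \/ eps = -1.
Implicit Types (p q : M) (v x y z w : 'rV[R]_(1 + m))
  (X Y Z : M -> 'rV[R]_(1 + m)).
Local Notation G := (@formF R m F gF).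
Local Notation Fp x := (incF (rsubmx (x : 'rV[R]_(1 + m)))).

Local Opaque coord_field dirder lie line_product.

Lemma tpartD x y : tpart (x + y) = tpart x + tpart y.
Proof. by rewrite /tpart mxE. Qed.

Lemma tpartZ a x : tpart (a *: x) = a * tpart x.
Proof. by rewrite /tpart mxE. Qed.

Lemma tpartB x y : tpart (x - y) = tpart x - tpart y.
Proof. by rewrite /tpart !mxE. Qed.

Lemma formFDl p x y z : G p (x + y) z = G p x z + G p y z.
Proof. by have := formF_linl hgF p 1 x y z; rewrite scale1r mul1r. Qed.

Lemma formFDr p x y z : G p z (x + y) = G p z x + G p z y.
Proof. by have := formF_linr hgF p 1 x y z; rewrite scale1r mul1r. Qed.

Lemma formFZl p a x z : G p (a *: x) z = a * G p x z.
Proof. by rewrite -[a *: x]addr0 formF_linl // formF0l // addr0. Qed.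

Lemma formFZr p a x z : G p z (a *: x) = a * G p z x.
Proof. by rewrite formFC // formFZl formFC. Qed.

(** pi^* omega kills d/dt and takes values in TF, so d/dt and dt stay parallel; skewness of omega in
    its last two slots preserves pi^* g_F. *)
Lemma pullback_parallel (D : connection M) om : tensor21 om -> skew21 gF om ->
  parallel_t gF D -> parallel_t gF (conn_add D (pullback om)).
Proof.
move=> tom skom [hD Dt Dp Dg].
have om0 r u : om r u 0 = 0.
  case: tom => _ /(_ r 1 0 0 u); rewrite !scale1r addr0 => /esym/eqP.
  by rewrite -subr_eq0 addrK => /eqP.
have oC r u u1 u2 : gF r (om r u u1) u2 + gF r u1 (om r u u2) = 0.
  by case: hgF => _ gC _ _; have [_ ->] := skom r u u1 u2; rewrite gC addNr.
split.
- exact: (conn_add_is_connection hD (pullback_tensor21 tom)).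
- move=> p v; rewrite /conn_add Dt pullbackE rsub_unit om0 add0r.
  by rewrite /incF row_mx0.
- move=> p v Y sY; rewrite (Dp _ _ _ sY) /conn_add tpartD pullbackE.
  by rewrite tpart_incF addr0.
- move=> p v Y Z sY sZ; rewrite (Dg _ _ _ _ sY sZ) /conn_add !pullbackE.
  rewrite formFDl formFDr addrACA.
  rewrite [X in _ = _ + X](_ : _ = 0) ?addr0 //.
  by rewrite /formF !rsub_incF oC.
Qed.

Variable f : R -> R.
Hypothesis f_smooth : smoothR f.
Hypothesis f_gt0 : forall t, 0 < f t.

Lemma f_neq0 t : f t != 0. Proof. by rewrite gt_eqF. Qed.

Lemma smoothR_derive1 (phi : R -> R) : smoothR phi -> smoothR (derive1 phi).
Proof. by move=> sphi k t; rewrite -derive1Sn; exact: sphi. Qed.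

(** The classical difference between the Levi-Civita connections of the warped and of the product
    metric, as the Koszul formula gives it. *)
Definition warp_diff p x y : 'rV[R]_(1 + m) :=
  (- (eps * (f (tcoord p) * derive1 f (tcoord p))) * G p x y) *: unit_t +
  (derive1 f (tcoord p) / f (tcoord p)) *:
    (tpart x *: Fp y + tpart y *: Fp x).

Lemma tpart_warp_diff p x y :
  tpart (warp_diff p x y) = - (eps * (f (tcoord p) * derive1 f (tcoord p))) * G p x y.
Proof.
rewrite tpartD !tpartZ tpart_unit tpartD !tpartZ !tpart_incF.
by rewrite !mulr0 addr0 mulr0 addr0 mulr1.
Qed.

Lemma formF_warp_diff p x y z : G p (warp_diff p x y) z =
  (derive1 f (tcoord p) / f (tcoord p)) * (tpart x * G p y z + tpart y * G p x z).
Proof.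
rewrite formFDl !formFZl formF_unitl // mulr0 add0r.
by rewrite formFDl !formFZl !formF_Fl.
Qed.

(** It is enough that the right side is metric and torsion-free at [p]. Torsion is unchanged because
    [warp_diff] is symmetric; for the metric property, the derivative of f^2 is matched by the f'/f
    terms. *)
Lemma warped_levi_civita (D0 D1 : connection M) p v Y :
  parallel_t gF D0 ->
  (forall q X Z, vf_smooth_at X q -> vf_smooth_at Z q -> torsion D0 X Z q = 0) ->
  levi_civita (warped eps f gF) D1 -> vf_smooth_at Y p ->
  D1 p v Y = D0 p v Y + warp_diff p v (Y p).
Proof.
move=> [hD0 Dt Dp Dg] tor0 [[hD1 met1] tor1] sY.
rewrite -/(conn_add D0 warp_diff p v Y).
apply: (@levi_civita_unique _ _ _ (warped eps f gF) _ _ _ _ _ _ _ _ _ sY).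
- exact: warped_bilinear.
- exact: warpedC.
- move=> x; apply: warped_nondegenerate => //; exact: f_neq0.
move=> D [] -> {D}; split; [exact: met1|exact: tor1| |]; last first.
  move=> X Z sX sZ; rewrite -[RHS](tor0 p X Z sX sZ) /torsion /conn_add.
  have -> : warp_diff p (X p) (Z p) = warp_diff p (Z p) (X p).
    by rewrite /warp_diff (formFC hgF) [in RHS]addrC addrC (addrC (_ *: Fp (Z p))).
  by rewrite opprD addrACA subrr addr0.
move=> w X Z sX sZ.
have fd : derivable f (tcoord p) 1 := @f_smooth 0%N (tcoord p).
have sf : fun_smooth_at (fun q : M => f (tcoord q)) p by exact: smooth_of_tcoord.
have sG : fun_smooth_at (fun q => G q (X q) (Z q)) p by exact: formF_smooth.
have st := fun_smoothM (tpart_smooth sX) (tpart_smooth sZ).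
rewrite (_ : (fun q => _) = (fun q => eps * (tpart (X q) * tpart (Z q)) +
    (f (tcoord q) * f (tcoord q)) * G q (X q) (Z q))); last first.
  by apply/funext => q; rewrite warpedE expr2.
rewrite (dirderD _ (fun_smoothM (fun_smooth_cst p eps) st)
  (fun_smoothM (fun_smoothM sf sf) sG)).
rewrite (dirderZ _ _ st) (dirderM _ (tpart_smooth sX) (tpart_smooth sZ)).
rewrite (dirderM _ (fun_smoothM sf sf) sG) (dirderM _ sf sf).
rewrite (dirder_tcoord _ fd) (Dp _ _ _ sX) (Dp _ _ _ sZ) (Dg _ _ _ _ sX sZ).
rewrite !warpedE /conn_add (tpartD (D0 p w X)) (tpartD (D0 p w Z)).
rewrite !tpart_warp_diff formFDl formFDr formF_warp_diff.
rewrite [G p (X p) (warp_diff _ _ _)](formFC hgF) formF_warp_diff.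
rewrite (formFC hgF p w (Z p)) (formFC hgF p (Z p) (X p)) (formFC hgF p w (X p)).
have := f_neq0 (tcoord p).
have := eps_sqr heps.
move: (tpart (D0 p w X)) (tpart (D0 p w Z)) (G p (D0 p w X) (Z p)).
move: (G p (X p) (D0 p w Z)) (G p (X p) (Z p)) (G p (X p) w) (G p (Z p) w).
move: (tpart (X p)) (tpart (Z p)) (tpart w) (f (tcoord p)) (derive1 f (tcoord p)).
clear; move=> tX tZ tw a b gxz' gxz gxw gzw gdz tDX tDZ ee a0.
(* The identity holds only modulo eps^2 = 1, so the difference of the sides is exhibited as a
   multiple of eps^2 - 1. *)
apply: subr0_eq; transitivity ((eps * eps - 1) *
  (a * b * (gxw * tZ + gzw * tX))); last by rewrite ee subrr mul0r.
by field.
Qed.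

End WarpedConnection.

(** * Curvature and Ricci tensor *)

Section WarpedCurvature.
Variables (R : realType) (m : nat) (F : manifold R m).
Local Notation M := (line_product F).
Variable gF : F -> 'rV[R]_m -> 'rV[R]_m -> R.
Hypothesis hgF : riemannian gF.
Implicit Types (p q : M) (v x y z w : 'rV[R]_(1 + m))
  (X Y Z : M -> 'rV[R]_(1 + m)).
Local Notation G := (@formF R m F gF).
Local Notation Fp x := (incF (rsubmx (x : 'rV[R]_(1 + m)))).

Local Opaque coord_field dirder lie line_product.

Section Twist.
Variables al be a : R -> R.

(* For al = u f^2, be = eps u and a = f'/f, where V = (u + eps f'/f) d/dt, this
   is [warp_diff] plus the vectorial torsion A_V. *)
Definition twist p x y : 'rV[R]_(1 + m) :=
  (al (tcoord p) * G p x y) *: unit_t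
  + ((- tpart y * be (tcoord p)) *: Fp x + (tpart x * a (tcoord p)) *: Fp y).

Lemma tpart_twist p x y : tpart (twist p x y) = al (tcoord p) * G p x y.
Proof.
rewrite tpartD tpartZ tpart_unit tpartD !tpartZ !tpart_incF.
by rewrite !mulr0 !addr0 mulr1.
Qed.

Lemma Fpart_twist p x y : rsubmx (twist p x y) =
  (- tpart y * be (tcoord p)) *: rsubmx x + (tpart x * a (tcoord p)) *: rsubmx y
    :> 'rV[R]_m.
Proof.
rewrite /twist linearD linearZ /= rsub_unit scaler0 add0r.
by rewrite linearD !linearZ /= !rsub_incF.
Qed.

Lemma formF_twist p x y z : G p x (twist p y z) =
  - tpart z * be (tcoord p) * G p x y + tpart y * a (tcoord p) * G p x z.
Proof.
rewrite (formFDr hgF) (formFZr hgF) (formF_unitr hgF) mulr0 add0r.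
by rewrite (formFDr hgF) !(formFZr hgF) !formF_Fr.
Qed.

Variables D0 D1 : connection M.
Hypothesis hD0 : parallel_t gF D0.
Hypothesis hD1 : is_connection D1.
Hypothesis D1E : forall p v Y, vf_smooth_at Y p ->
  D1 p v Y = D0 p v Y + twist p v (Y p).
Hypothesis al_smooth : forall p, fun_smooth_at (fun q : M => al (tcoord q)) p.
Hypothesis be_smooth : forall p, fun_smooth_at (fun q : M => be (tcoord q)) p.
Hypothesis a_smooth : forall p, fun_smooth_at (fun q : M => a (tcoord q)) p.
Hypothesis al_derivable : forall t, derivable al t 1.
Hypothesis be_derivable : forall t, derivable be t 1.
Hypothesis a_derivable : forall t, derivable a t 1.

Let conn0 : is_connection D0. Proof. by case: hD0. Qed.

(** The Christoffel symbols of [D0] at [p] in the chart at [p]; their antisymmetric part in [x], [y]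
    is the torsion. *)
Definition coord_conn p x y := D0 p x (coord_field p y).
Local Notation N := coord_conn.

Lemma tpart_coord_conn p x y : tpart (N p x y) = 0.
Proof.
case: hD0 => _ _ Dp _; rewrite -(Dp _ _ _ (coord_smooth p y)).
rewrite (@dirder_eq _ _ _ _ _ _ (fun=> tpart y)); first exact: dirder_cst.
by apply: filterS (near_cdom (cdom_mem p)) => q pq; exact: tpart_coord_field.
Qed.

(** The coordinate fields of [y] and of its F-part differ near [p] by a constant multiple of the
    parallel field d/dt. *)
Lemma coord_conn_Fpart p x y : N p x (Fp y) = N p x y.
Proof.
case: hD0 => _ Dt _ _; rewrite /N.
have E : \forall q \near p,
    coord_field p (Fp y) q = - tpart y *: unit_t + coord_field p y q.
  apply: filterS (near_cdom (cdom_mem p)) => q pq.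
  have -> : Fp y = - tpart y *: unit_t + y.
    by rewrite [in X in _ + X](split_tF y) addrA -scalerDl addNr scale0r add0r.
  by rewrite (coord_field_linear _ _ _ pq) (coord_field_unit pq).
rewrite (conn_local conn0 x (coord_smooth p (Fp y)) E).
rewrite (conn_linr conn0 _ _ (@unit_t_smooth _ _ _ p) (coord_smooth p y)).
by rewrite Dt scaler0 add0r.
Qed.

(** The twist on two coordinate fields, with dt and P moved from the fields to the vectors [y], [z]:
    every summand becomes a scalar function times a fixed field, ready for the Leibniz rule. *)
Definition coord_twist p y z q : 'rV[R]_(1 + m) :=
  (al (tcoord q) * G q (coord_field p y q) (coord_field p z q)) *: unit_t
  + ((- tpart z * be (tcoord q)) *: coord_field p (Fp y) q
     + (tpart y * a (tcoord q)) *: coord_field p (Fp z) q).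

Lemma near_coord_twist p y z : \forall q \near p,
  twist q (coord_field p y q) (coord_field p z q) = coord_twist p y z q.
Proof.
apply: filterS (near_cdom (cdom_mem p)) => q pq.
rewrite /twist /coord_twist (tpart_coord_field y pq) (tpart_coord_field z pq).
rewrite (rsub_coord_field y pq) (rsub_coord_field z pq).
by rewrite -(coord_field_incF _ pq) -(coord_field_incF _ pq).
Qed.

Let G_smooth p y z : fun_smooth_at
  (fun q => G q (coord_field p y q) (coord_field p z q)) p.
Proof. exact: (formF_smooth hgF (coord_smooth p y) (coord_smooth p z)). Qed.

Let al_term p y z : vf_smooth_at (fun q => (al (tcoord q) *
  G q (coord_field p y q) (coord_field p z q)) *: unit_t) p.
Proof.
exact: (vf_smoothZ (fun_smoothM (al_smooth p) (G_smooth p y z))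
  (@unit_t_smooth _ _ _ p)).
Qed.

Let F_term p (c : R) (phi : R -> R) y :
  (forall p, fun_smooth_at (fun q : M => phi (tcoord q)) p) ->
  vf_smooth_at (fun q => (c * phi (tcoord q)) *: coord_field p y q) p.
Proof.
move=> sphi.
exact: (vf_smoothZ (fun_smoothM (fun_smooth_cst p c) (sphi p)) (coord_smooth p y)).
Qed.

Lemma coord_twist_smooth p y z : vf_smooth_at (coord_twist p y z) p.
Proof.
exact: (vf_smoothD (@al_term p y z) (vf_smoothD (@F_term p (- tpart z) be (Fp y) be_smooth)
  (@F_term p (tpart y) a (Fp z) a_smooth))).
Qed.

Let conn_F_term p x (c : R) (phi : R -> R) y :
  (forall p, fun_smooth_at (fun q : M => phi (tcoord q)) p) ->
  (forall t, derivable phi t 1) ->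
  D0 p x (fun q => (c * phi (tcoord q)) *: coord_field p (Fp y) q) =
  (c * (tpart x * derive1 phi (tcoord p))) *: Fp y + (c * phi (tcoord p)) *: N p x y.
Proof.
move=> sphi dphi.
rewrite (conn_leibniz conn0 _ (fun_smoothM (fun_smooth_cst p c) (sphi p))
  (coord_smooth p (Fp y))).
rewrite (dirderZ _ _ (sphi p)) (dirder_tcoord _ (dphi _)) coord_field_id.
by rewrite -/(N p x (Fp y)) coord_conn_Fpart.
Qed.

Lemma conn_coord_twist p x y z : D0 p x (coord_twist p y z) =
  (al (tcoord p) * (G p (N p x y) z + G p y (N p x z))
   + G p y z * (tpart x * derive1 al (tcoord p))) *: unit_t
  + (((- tpart z * (tpart x * derive1 be (tcoord p))) *: Fp y
      + (- tpart z * be (tcoord p)) *: N p x y)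
     + ((tpart y * (tpart x * derive1 a (tcoord p))) *: Fp z
      + (tpart y * a (tcoord p)) *: N p x z)).
Proof.
case: (hD0) => _ Dt _ Dg.
have sB := @F_term p (- tpart z) be (Fp y) be_smooth.
have sA := @F_term p (tpart y) a (Fp z) a_smooth.
have EB := @conn_F_term p x (- tpart z) be y be_smooth be_derivable.
have EA := @conn_F_term p x (tpart y) a z a_smooth a_derivable.
have EAB := etrans (conn_addf conn0 x sB sA) (congr2 +%R EB EA).
apply: (etrans (conn_addf conn0 x (@al_term p y z) (vf_smoothD sB sA))).
apply: congr2 EAB.
apply: (etrans (conn_leibniz conn0 x
  (fun_smoothM (al_smooth p) (@G_smooth p y z)) (@unit_t_smooth _ _ _ p))).
rewrite Dt scaler0 addr0; congr (_ *: _).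
apply: (etrans (dirderM x (al_smooth p) (@G_smooth p y z))).
apply: congr2.
  rewrite (Dg p x _ _ (coord_smooth p y) (coord_smooth p z)).
  by rewrite !coord_field_id.
by rewrite !coord_field_id (dirder_tcoord _ (@al_derivable _)).
Qed.

Lemma conn_conn_coord p x y z :
  D1 p x (fun q => D1 q (coord_field p y q) (coord_field p z)) =
  D0 p x (fun q => D0 q (coord_field p y q) (coord_field p z))
  + D0 p x (coord_twist p y z)
  + twist p x (N p y z + twist p y z).
Proof.
have s0 := conn_coord_smooth conn0 (p := p) y z.
have s1 := conn_coord_smooth hD1 (p := p) y z.
have E : \forall q \near p, D1 q (coord_field p y q) (coord_field p z) =
    D0 q (coord_field p y q) (coord_field p z) + coord_twist p y z q.
  apply: filterS (filterI (near_cdom (cdom_mem p)) (near_coord_twist p y z)).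
  by move=> q [pq <-]; rewrite D1E //; exact: coord_field_smooth.
(* The inner derivative has to be replaced as a field near [p] before the outer one can be
   expanded. *)
rewrite (conn_local hD1 x s1 E).
rewrite (D1E _ (vf_smoothD s0 (@coord_twist_smooth p y z))).
rewrite (conn_addf conn0 _ s0 (@coord_twist_smooth p y z)).
by rewrite -(nbhs_singleton (near_coord_twist p y z)) !coord_field_id.
Qed.

Lemma tpart_conn_twist p x y z : tpart (D0 p x (coord_twist p y z)) =
  al (tcoord p) * (G p (N p x y) z + G p y (N p x z))
   + G p y z * (tpart x * derive1 al (tcoord p)).
Proof.
rewrite conn_coord_twist; set c := _ + _ * _; clearbody c.
move: (tpart_coord_conn p x y) (tpart_coord_conn p x z).
move: (N p x y) (N p x z) => n1 n2 t1 t2.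
rewrite tpartD tpartZ tpart_unit tpartD (tpartD (_ *: Fp y)) (tpartD (_ *: Fp z)).
by rewrite !tpartZ !tpart_incF t1 t2 !mulr0 !addr0 mulr1.
Qed.

Lemma Fpart_conn_twist p x y z : rsubmx (D0 p x (coord_twist p y z)) =
  ((- tpart z * (tpart x * derive1 be (tcoord p))) *: rsubmx y
      + (- tpart z * be (tcoord p)) *: rsubmx (N p x y))
     + ((tpart y * (tpart x * derive1 a (tcoord p))) *: rsubmx z
      + (tpart y * a (tcoord p)) *: rsubmx (N p x z)) :> 'rV[R]_m.
Proof.
rewrite conn_coord_twist; set c := _ + _ * _; clearbody c.
move: (N p x y) (N p x z) => n1 n2.
rewrite linearD linearZ /= rsub_unit scaler0 add0r linearD /=; congr (_ + _);
  by rewrite linearD !linearZ /= rsub_incF.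
Qed.

Let tpart_sub (A1 A2 A3 B1 B2 B3 : 'rV[R]_(1 + m)) :
  tpart (A1 + A2 + A3 - (B1 + B2 + B3)) =
  tpart A1 - tpart B1 + (tpart A2 + tpart A3 - (tpart B2 + tpart B3)).
Proof. by rewrite tpartB !tpartD; ring. Qed.

Let Fpart_sub (A1 A2 A3 B1 B2 B3 : 'rV[R]_(1 + m)) :
  rsubmx (A1 + A2 + A3 - (B1 + B2 + B3)) =
  rsubmx A1 - rsubmx B1 + (rsubmx A2 + rsubmx A3 - (rsubmx B2 + rsubmx B3))
    :> 'rV[R]_m.
Proof. by apply/rowP => i; rewrite !mxE; ring. Qed.

Let tpart_twist_conn p x y z : tpart (twist p x (N p y z + twist p y z)) =
  al (tcoord p) * (G p x (N p y z) + (- tpart z * be (tcoord p) * G p x y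
    + tpart y * a (tcoord p) * G p x z)).
Proof. by rewrite tpart_twist (formFDr hgF p (N p y z)) formF_twist. Qed.

Let Fpart_twist_conn p x y z : rsubmx (twist p x (N p y z + twist p y z)) =
  (- (al (tcoord p) * G p y z) * be (tcoord p)) *: rsubmx x
  + (tpart x * a (tcoord p)) *: (rsubmx (N p y z)
    + ((- tpart z * be (tcoord p)) *: rsubmx y
       + (tpart y * a (tcoord p)) *: rsubmx z)) :> 'rV[R]_m.
Proof.
rewrite Fpart_twist (tpartD (N p y z)) tpart_coord_conn add0r tpart_twist.
by rewrite [rsubmx (N p y z + _)]linearD /= Fpart_twist.
Qed.

(** The [be] terms cancel by symmetry of G(x, y), and the [a] terms merge into dal - al a. *)
Let tpart_identity (dal al0 be0 a0 tx ty tz gxy gxz gyz gnxyz gnyxz gynxz gxnyz : R) :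
  al0 * (gnxyz + gynxz) + gyz * (tx * dal)
  + al0 * (gxnyz + (- tz * be0 * gxy + ty * a0 * gxz))
  - (al0 * (gnyxz + gxnyz) + gxz * (ty * dal)
     + al0 * (gynxz + (- tz * be0 * gxy + tx * a0 * gyz))) =
  (dal - al0 * a0) * (tx * gyz - ty * gxz) + al0 * (gnxyz - gnyxz).
Proof. by ring. Qed.

(** All terms containing [a] without [be] cancel, those in [da] and a^2 by symmetry in x and y: this
    is where a dt is closed and P is parallel. *)
Let Fpart_identity (dbe da al0 be0 a0 tx ty tz gxz gyz : R)
    (rx ry rz nxy nyx nxz nyz : 'rV[R]_m) :
  ((- tz * (tx * dbe)) *: ry + (- tz * be0) *: nxy)
   + ((ty * (tx * da)) *: rz + (ty * a0) *: nxz)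
  + ((- (al0 * gyz) * be0) *: rx
     + (tx * a0) *: (nyz + ((- tz * be0) *: ry + (ty * a0) *: rz)))
  - (((- tz * (ty * dbe)) *: rx + (- tz * be0) *: nyx)
     + ((tx * (ty * da)) *: rz + (tx * a0) *: nyz)
    + ((- (al0 * gxz) * be0) *: ry
       + (ty * a0) *: (nxz + ((- tz * be0) *: rx + (tx * a0) *: rz)))) =
  - (((dbe + a0 * be0) * tz) *: (tx *: ry - ty *: rx)
     + (be0 * tz) *: (nxy - nyx)
     + (al0 * be0) *: (gyz *: rx - gxz *: ry)).
Proof. by apply/rowP => i; rewrite !mxE; ring. Qed.

Lemma tpart_curv_twist p x y z : tpart (curv D1 p x y z) =
  tpart (curv D0 p x y z)
  + ((derive1 al (tcoord p) - al (tcoord p) * a (tcoord p))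
       * (tpart x * G p y z - tpart y * G p x z)
     + al (tcoord p) * (G p (N p x y) z - G p (N p y x) z)).
Proof.
rewrite (curvE hD1) (curvE conn0) !conn_conn_coord tpart_sub [in RHS]tpartB.
congr (_ + _).
rewrite (tpart_conn_twist p x y z) (tpart_conn_twist p y x z).
rewrite (tpart_twist_conn p x y z) (tpart_twist_conn p y x z) (formFC hgF p y x).
exact: tpart_identity.
Qed.

(** Three effects appear: the derivative of [be] corrected by [a], the torsion of [D0], and the
    quadratic term al be of constant-curvature type. The last one alone survives when [x], [y], [z]
    are tangent to F. *)
Lemma Fpart_curv_twist p x y z : rsubmx (curv D1 p x y z) =
  rsubmx (curv D0 p x y z)
  - (((derive1 be (tcoord p) + a (tcoord p) * be (tcoord p)) * tpart z)
      *: (tpart x *: rsubmx y - tpart y *: rsubmx x)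
    + (be (tcoord p) * tpart z) *: (rsubmx (N p x y) - rsubmx (N p y x))
    + (al (tcoord p) * be (tcoord p))
      *: (G p y z *: rsubmx x - G p x z *: rsubmx y)) :> 'rV[R]_m.
Proof.
rewrite (curvE hD1) (curvE conn0) !conn_conn_coord Fpart_sub.
rewrite [rsubmx (D0 _ _ _ - _)]linearB; congr (_ + _).
rewrite (Fpart_conn_twist p x y z) (Fpart_conn_twist p y x z).
rewrite (Fpart_twist_conn p x y z) (Fpart_twist_conn p y x z).
exact: Fpart_identity.
Qed.

End Twist.
End WarpedCurvature.

(** * The Ricci tensor in an adapted basis *)

Section WarpedRicci.
Variables (R : realType) (m : nat) (F : manifold R m).
Local Notation M := (line_product F).
Variable gF : F -> 'rV[R]_m -> 'rV[R]_m -> R.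
Hypothesis hgF : riemannian gF.
Variable eps : R.
Hypothesis heps : eps = 1 \/ eps = -1.
Implicit Types (p q : M) (v x y z w : 'rV[R]_(1 + m))
  (X Y Z : M -> 'rV[R]_(1 + m)).
Local Notation G := (@formF R m F gF).
Local Notation Fp x := (incF (rsubmx (x : 'rV[R]_(1 + m)))).

Local Opaque coord_field dirder lie line_product.

(** Since dt is parallel and constant on coordinate fields, the inner derivative has no d/dt part
    near [p], and hence neither has its derivative. *)
Lemma curv_parallel_tpart (D : connection M) p x y z : parallel_t gF D ->
  tpart (curv D p x y z) = 0.
Proof.
move=> [hD _ Dp _]; rewrite (curvE hD) tpartB.
suff H v w : tpart (D p v (fun q => D q (coord_field p w q) (coord_field p z))) = 0.
  exact: etrans (congr2 (fun a b => a - b) (H x y) (H y x)) (subrr 0).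
rewrite -(Dp _ _ _ (conn_coord_smooth hD (p := p) w z)).
rewrite (@dirder_eq _ _ _ _ _ _ (fun=> 0)); first exact: dirder_cst.
apply: filterS (near_cdom (cdom_mem p)) => q pq.
rewrite -(Dp _ _ _ (coord_field_smooth z pq)).
rewrite (@dirder_eq _ _ _ _ _ _ (fun=> tpart z)); first exact: dirder_cst.
by apply: filterS (near_cdom pq) => r pr; exact: tpart_coord_field.
Qed.

Lemma curv_parallel_unit (D : connection M) p x y : parallel_t gF D ->
  curv D p x y unit_t = 0.
Proof.
move=> [hD Dt _ _]; rewrite (curvE hD).
suff H v w :
    D p v (fun q => D q (coord_field p w q) (coord_field p unit_t)) = 0.
  exact: etrans (congr2 (fun a b => a - b) (H x y) (H y x)) (subrr 0).
rewrite -[RHS](conn0r hD p v).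
apply: (conn_local hD v (conn_coord_smooth hD (p := p) w unit_t)).
apply: filterS (near_cdom (cdom_mem p)) => q pq.
rewrite -(Dt q (coord_field p w q)).
apply: (conn_local hD _ (coord_field_smooth unit_t pq)).
by apply: filterS (near_cdom pq) => r pr; exact: coord_field_unit.
Qed.

Lemma formF_onb_exists (r : F) : exists e : 'M[R]_m,
  forall i j, gF r (row i e) (row j e) = (i == j)%:R.
Proof.
case: hgF => bg gC pg _; have [gl gr] := bg r.
have sym : (form_mx (gF r))^T = form_mx (gF r).
  by apply/matrixP => i j; rewrite !mxE gC.
have pos (u : 'rV[R]_m) : u != 0 -> 0 < (u *m form_mx (gF r) *m u^T) 0 0.
  by move=> u0; rewrite -form_mxE //; exact: pg.
have [e eE] := gram_schmidt sym pos (leqnn m).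
by exists e => i j; rewrite form_mx_rows // eE mxE.
Qed.

Variable f : R -> R.
Hypothesis f_gt0 : forall t, 0 < f t.

Local Notation g := (warped eps f gF).

(** The sum is evaluated in the basis d/dt, e_i / f: d/dt has square [eps], and the rescaling of the
    e_i accounts for f^-2. *)
Lemma ricci_warped (D : connection M) p (e : 'M[R]_m) x y :
  is_connection D ->
  (forall i j, gF (projF p) (row i e) (row j e) = (i == j)%:R) ->
  ricci (warped eps f gF) D p x y =
    eps * warped eps f gF p (curv D p x unit_t unit_t) y +
    \sum_i (f (tcoord p) ^+ 2)^-1 * warped eps f gF p
       (curv D p x (incF (row i e)) (incF (row i e))) y.
Proof.
move=> hD eE; set c := f (tcoord p).
have c0 : c != 0 by exact: lt0r_neq0 (f_gt0 _).
have gl := (warped_bilinear hgF eps f p).1.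
have gr := (warped_bilinear hgF eps f p).2.
pose b v w := g p (curv D p x v w) y.
have bl a u v w : b (a *: u + v) w = a * b u w + b v w.
  by rewrite /b (curv_linear2 hD); exact: gl.
have br a u v w : b w (a *: u + v) = a * b w u + b w v.
  by rewrite /b (curv_linear3 hD); exact: gl.
pose E : 'M[R]_(1 + m) := col_mx unit_t (c^-1 *: row_mx 0 e).
have E0 : row (lshift m 0) E = unit_t by rewrite rowKu row_id.
have E1 i : row (rshift 1 i) E = c^-1 *: incF (row i e).
  by rewrite rowKd linearZ /= row_row_mx row0.
have gtt : g p unit_t unit_t = eps by rewrite warped_unitr // tpart_unit mulr1.
have gFF i j : g p (c^-1 *: incF (row i e)) (c^-1 *: incF (row j e)) =
    (i == j)%:R.
  rewrite warpedE !tpartZ !tpart_incF !mulr0 add0r.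
  rewrite (formFZl hgF) (formFZr hgF) /formF !rsub_incF eE -/c.
  by rewrite !mulrA expr2 mulfK // mulfV // mul1r.
have gtF i : g p unit_t (c^-1 *: incF (row i e)) = 0.
  rewrite warpedE tpartZ tpart_incF !mulr0 (formF_unitl hgF) mulr0.
  exact: addr0.
have gFt i : g p (c^-1 *: incF (row i e)) unit_t = 0.
  exact: etrans (warpedC hgF _ _ _ _ _) (gtF i).
have onbE : is_onb g p E.
  move=> i j; case: (split_ordP i) => i' ->{i}; case: (split_ordP j) => j' ->{j}.
  - by rewrite !ord1 eqxx E0 gtt.
  - by rewrite (ord1 i') eq_lrshift E0 E1 gtF.
  - by rewrite (ord1 j') eq_rlshift E0 E1 gFt.
  - rewrite eq_rshift !E1 gFF gFF eqxx; case: eqP => _ //; first by left.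
(* [onb] falls back on the zero matrix when no orthonormal basis exists; [E] excludes this. *)
have onbO : is_onb g p (onb g p) by apply: (@xgetPex _ 0 [set e | is_onb g p e]); exists E.
rewrite /ricci (onb_trace gl gr bl br onbO) -(onb_trace gl gr bl br onbE).
rewrite big_split_ord; apply: congr2.
  by rewrite big_ord1 E0 gtt.
apply: eq_bigr => i _; rewrite !E1 gFF eqxx mul1r.
have bZl a u v : b (a *: u) v = a * b u v.
  have := bl a u 0 v; rewrite addr0 => ->; rewrite -[RHS]addr0; congr (_ + _).
  by have := bl 1 0 0 v; rewrite scale1r addr0 mul1r => /esym/eqP;
    rewrite -subr_eq0 addrK => /eqP.
have bZr a u v : b v (a *: u) = a * b v u.
  have := br a u 0 v; rewrite addr0 => ->; rewrite -[RHS]addr0; congr (_ + _).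
  by have := br 1 0 0 v; rewrite scale1r addr0 mul1r => /esym/eqP;
    rewrite -subr_eq0 addrK => /eqP.
by rewrite bZl bZr mulrA -expr2 exprVn.
Qed.

End WarpedRicci.

(** * The correction term for the vectorial torsion of the theorem *)

Section WarpedTwist.
Variables (R : realType) (m : nat) (F : manifold R m).
Local Notation M := (line_product F).
Variable gF : F -> 'rV[R]_m -> 'rV[R]_m -> R.
Hypothesis hgF : riemannian gF.
Variable eps : R.
Hypothesis heps : eps = 1 \/ eps = -1.
Variable f : R -> R.
Hypothesis f_smooth : smoothR f.
Hypothesis f_gt0 : forall t, 0 < f t.
Variable h : R -> R.
Hypothesis h_smooth : smoothR h.
Implicit Types (p q : M) (v x y z w : 'rV[R]_(1 + m))
  (X Y Z : M -> 'rV[R]_(1 + m)).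
Local Notation G := (@formF R m F gF).
Local Notation Fp x := (incF (rsubmx (x : 'rV[R]_(1 + m)))).
Local Notation V := (fun z : M => h (tcoord z) *: partial_t z).

Local Opaque coord_field dirder lie line_product.

Definition warp_a t : R := derive1 f t / f t.
(* V = (warp_u + eps f'/f) d/dt, so the theorem says that warp_u = 0. *)
Definition warp_u t : R := h t - eps * warp_a t.
Definition warp_al t : R := warp_u t * (f t * f t).
Definition warp_be t : R := eps * warp_u t.

Let f0 t : f t != 0. Proof. exact: lt0r_neq0 (f_gt0 t). Qed.

Lemma vectorial_twist p x y :
  warp_diff gF eps f p x y + vectorial (warped eps f gF) V p x y =
  twist gF warp_al warp_be warp_a p x y.
Proof.
have gV : warped eps f gF p (h (tcoord p) *: unit_t) y =
    eps * (h (tcoord p) * tpart y).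
  rewrite warpedE tpartZ tpart_unit mulr1 (formFZl hgF) (formF_unitl hgF).
  by rewrite !mulr0 addr0.
rewrite /vectorial partial_tE gV warpedE /warp_diff.
rewrite [in X in _ - X](split_tF x).
rewrite /twist /warp_al /warp_be /warp_u /warp_a.
have ee := eps_sqr heps; have a0 := f0 (tcoord p).
move: (Fp x) (Fp y) (@unit_t R m) (tpart x) (tpart y) (G p x y) => X Y e tx ty g.
move: (f (tcoord p)) (derive1 f (tcoord p)) (h (tcoord p)) a0 => a b c a0.
apply/rowP => i; rewrite !mxE.
move: (X 0 i) (Y 0 i) (e 0 i) => Xi Yi ei.
(* Again the sides agree only modulo eps^2 = 1. *)
apply: subr0_eq; transitivity ((eps * eps - 1) * (b / a * ty * - Xi)).
  by field.
by rewrite ee subrr mul0r.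
Qed.

Let df t : derivable f t 1. Proof. exact: (@f_smooth 0%N t). Qed.

Let dh t : derivable h t 1. Proof. exact: (@h_smooth 0%N t). Qed.

Lemma warp_a_derivable t : derivable warp_a t 1.
Proof.
apply: derivableM; last by apply: derivableV; [exact: f0|exact: df].
exact: (smoothR_derive1 f_smooth (k := 0%N)).
Qed.

Lemma warp_u_derivable t : derivable warp_u t 1.
Proof.
apply: derivableB; first exact: dh.
by apply: derivableM; [exact: derivable_cst|exact: warp_a_derivable].
Qed.

Lemma warp_al_derivable t : derivable warp_al t 1.
Proof.
apply: derivableM; first exact: warp_u_derivable.
by apply: derivableM; exact: df.
Qed.

Lemma warp_be_derivable t : derivable warp_be t 1.
Proof.
by apply: derivableM; [exact: derivable_cst|exact: warp_u_derivable].
Qed.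

(** Differentiating f^2 produces 2 a f^2 u; subtracting al a leaves one copy. The same u' + u a
    arises from [warp_be], so one scalar equation makes both coefficients vanish. *)
Lemma derive_warp_al t : derive1 warp_al t - warp_al t * warp_a t =
  f t ^+ 2 * (derive1 warp_u t + warp_u t * warp_a t).
Proof.
have dff : derivable (fun t => f t * f t) t 1.
  by apply: derivableM; exact: df.
have -> : derive1 warp_al t = warp_u t * (f t * derive1 f t + f t * derive1 f t)
    + f t * f t * derive1 warp_u t.
  rewrite !derive1E [LHS](deriveM (@warp_u_derivable t) dff).
  congr (_ * _ + _).
  by rewrite [LHS](deriveM (@df t) (@df t)).
rewrite /warp_al; move: (warp_u t) (derive1 warp_u t) => u du.
have := f0 t; rewrite /warp_a; move: (f t) (derive1 f t) => b c b0.
by field.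
Qed.

Lemma derive_warp_be t : derive1 warp_be t + warp_a t * warp_be t =
  eps * (derive1 warp_u t + warp_u t * warp_a t).
Proof.
have -> : derive1 warp_be t = eps * derive1 warp_u t.
  rewrite !derive1E [LHS](deriveM (derivable_cst eps t 1) (@warp_u_derivable t)).
  by rewrite derive_cst scaler0 addr0.
by rewrite /warp_be; ring.
Qed.

Lemma f_tcoord_smooth p : fun_smooth_at (fun q : M => f (tcoord q)) p.
Proof. exact: smooth_of_tcoord. Qed.

Lemma warp_a_smooth p : fun_smooth_at (fun q : M => warp_a (tcoord q)) p.
Proof.
apply: fun_smoothM (smooth_of_tcoord p (smoothR_derive1 f_smooth)) _.
by apply: fun_smoothV (f_tcoord_smooth p) => q; exact: f0.
Qed.

Lemma warp_u_smooth p : fun_smooth_at (fun q : M => warp_u (tcoord q)) p.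
Proof.
have := fun_smoothD (smooth_of_tcoord p h_smooth)
  (fun_smoothM (fun_smooth_cst p (- eps)) (warp_a_smooth p)).
by congr fun_smooth_at; apply/funext => q; rewrite mulNr.
Qed.

Lemma warp_al_smooth p : fun_smooth_at (fun q : M => warp_al (tcoord q)) p.
Proof.
exact: (fun_smoothM (warp_u_smooth p)
  (fun_smoothM (f_tcoord_smooth p) (f_tcoord_smooth p))).
Qed.

Lemma warp_be_smooth p : fun_smooth_at (fun q : M => warp_be (tcoord q)) p.
Proof. exact: (fun_smoothM (fun_smooth_cst p eps) (warp_u_smooth p)). Qed.

Lemma warped_smooth p X Y : vf_smooth_at X p -> vf_smooth_at Y p ->
  fun_smooth_at (fun q => warped eps f gF q (X q) (Y q)) p.
Proof.
move=> sX sY; have st := fun_smoothM (tpart_smooth sX) (tpart_smooth sY).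
have sff := fun_smoothM (f_tcoord_smooth p) (f_tcoord_smooth p).
have := fun_smoothD (fun_smoothM (fun_smooth_cst p eps) st)
  (fun_smoothM sff (formF_smooth hgF sX sY)).
by congr fun_smooth_at; apply/funext => q; rewrite warpedE expr2.
Qed.

Lemma vectorial_tensor21 : tensor21 (vectorial (warped eps f gF) V).
Proof.
have gl p := (warped_bilinear hgF eps f p).1.
have gr p := (warped_bilinear hgF eps f p).2.
have sV p : vf_smooth_at V p.
  have -> : V = (fun q : M => h (tcoord q) *: unit_t).
    by apply/funext => q; rewrite partial_tE.
  exact: (vf_smoothZ (smooth_of_tcoord p h_smooth) (@unit_t_smooth _ _ _ p)).
have idl c g1 g2 g3 (u x y : 'rV[R]_(1 + m)) :
    (c * g1 + g2) *: u - g3 *: (c *: x + y) =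
    c *: (g1 *: u - g3 *: x) + (g2 *: u - g3 *: y).
  by apply/rowP => i; rewrite !mxE; ring.
have idr c g1 g2 g3 g4 (u x : 'rV[R]_(1 + m)) :
    (c * g1 + g2) *: u - (c * g3 + g4) *: x =
    c *: (g1 *: u - g3 *: x) + (g2 *: u - g4 *: x).
  by apply/rowP => i; rewrite !mxE; ring.
split.
- by move=> p c x y z; rewrite /vectorial gl; exact: idl.
- move=> p c x y z; rewrite /vectorial (gr p c x y z) (gr p c x y (V p)).
  exact: idr.
- move=> p X Y sX sY; rewrite /vectorial.
  exact: (vf_smoothB (vf_smoothZ (warped_smooth sX sY) (sV p))
    (vf_smoothZ (warped_smooth (sV p) sY) sX)).
Qed.

End WarpedTwist.

(** * Comparison of the two Ricci tensors *)

Section RicciComparison.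
Variables (R : realType) (m : nat) (F : manifold R m).
Local Notation M := (line_product F).
Variable gF : F -> 'rV[R]_m -> 'rV[R]_m -> R.
Hypothesis hgF : riemannian gF.
Variable eps : R.
Hypothesis heps : eps = 1 \/ eps = -1.
Variable f : R -> R.
Hypothesis f_smooth : smoothR f.
Hypothesis f_gt0 : forall t, 0 < f t.
Variable h : R -> R.
Hypothesis h_smooth : smoothR h.
Variable om : F -> 'rV[R]_m -> 'rV[R]_m -> 'rV[R]_m.
Hypothesis om_tensor : tensor21 om.
Hypothesis om_skew : skew21 gF om.
Variables nabla_warped nabla_prod : connection M.
Hypothesis hwarped : levi_civita (warped eps f gF) nabla_warped.
Hypothesis hprod : levi_civita (product_metric eps gF) nabla_prod.
Implicit Types (p q : M) (v x y z w : 'rV[R]_(1 + m))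
  (X Y Z : M -> 'rV[R]_(1 + m)).
Local Notation G := (@formF R m F gF).
Local Notation V := (fun z : M => h (tcoord z) *: partial_t z).
Local Notation g := (warped eps f gF).
Local Notation D0 := (conn_add nabla_prod (pullback om)).
Local Notation D1 := (conn_add (conn_add nabla_warped (pullback om))
  (vectorial (warped eps f gF) V)).
Local Notation al := (warp_al eps f h).
Local Notation be := (warp_be eps f h).
Local Notation a := (warp_a f).
Local Notation u := (warp_u eps f h).

Local Opaque coord_field dirder lie line_product.

Let prod_parallel : parallel_t gF nabla_prod.
Proof. exact: (levi_civita_product_parallel hgF heps hprod). Qed.

Let D0_parallel : parallel_t gF D0.
Proof. exact: (pullback_parallel hgF om_tensor om_skew prod_parallel). Qed.

Let D0_conn : is_connection D0. Proof. by case: D0_parallel. Qed.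

Let D1_conn : is_connection D1.
Proof.
have [[hW _] _] := hwarped.
exact: (conn_add_is_connection (conn_add_is_connection hW
  (pullback_tensor21 om_tensor)) (vectorial_tensor21 hgF eps f_smooth h_smooth)).
Qed.

(** Uniqueness of the Levi-Civita connection concerns torsion-free connections, so it is applied
    before pi^* omega and A_V are added. *)
Let D1E p v Y : vf_smooth_at Y p ->
  D1 p v Y = D0 p v Y + twist gF al be a p v (Y p).
Proof.
move=> sY; rewrite -(vectorial_twist hgF heps f_gt0 h) /conn_add.
have tor0 : forall q X Z, vf_smooth_at X q -> vf_smooth_at Z q ->
  torsion nabla_prod X Z q = 0 by case: hprod.
rewrite (warped_levi_civita hgF heps f_smooth f_gt0 v prod_parallel tor0 hwarped sY).
move: (nabla_prod p v Y) (pullback _ _ _ _) (warp_diff _ _ _ _ _ _).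
by move=> A B C; rewrite [RHS]addrA (addrAC A C B).
Qed.

(** Symmetry of the Levi-Civita symbols moves d/dt to the parallel slot, and pi^* omega kills it.
    With [coord_conn_unitr] this removes the torsion whenever d/dt is one of the two arguments. *)
Let coord_conn_unit p x : coord_conn D0 p unit_t x = 0.
Proof.
case: (prod_parallel) => hD Dt _ _; have [_ tor0] := hprod.
rewrite /coord_conn /conn_add (@torsion_free_coord _ _ _ nabla_prod p unit_t x (tor0 p)).
rewrite (conn_local hD x (coord_smooth p unit_t) (near_coord_unit p)) Dt add0r.
rewrite pullbackE rsub_unit; case: om_tensor => oml _ _.
have := oml (projF p) 1 0 0 (rsubmx (coord_field p x p)).
rewrite !scale1r addr0 => /esym/eqP; rewrite -subr_eq0 addrK => /eqP ->.
by rewrite /incF row_mx0.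
Qed.

Let coord_conn_unitr p x : coord_conn D0 p x unit_t = 0.
Proof.
case: (D0_parallel) => hD Dt _ _; rewrite /coord_conn.
by rewrite (conn_local hD x (coord_smooth p unit_t) (near_coord_unit p)) Dt.
Qed.

Let tpart_curv p x y z := tpart_curv_twist hgF D0_parallel D1_conn D1E
  (warp_al_smooth eps f_smooth f_gt0 h_smooth)
  (warp_be_smooth eps f_smooth f_gt0 h_smooth)
  (warp_a_smooth f_smooth f_gt0)
  (@warp_al_derivable _ eps _ f_smooth f_gt0 _ h_smooth)
  (@warp_be_derivable _ eps _ f_smooth f_gt0 _ h_smooth)
  (@warp_a_derivable _ _ f_smooth f_gt0) p x y z.

Let Fpart_curv p x y z := Fpart_curv_twist hgF D0_parallel D1_conn D1E
  (warp_al_smooth eps f_smooth f_gt0 h_smooth)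
  (warp_be_smooth eps f_smooth f_gt0 h_smooth)
  (warp_a_smooth f_smooth f_gt0)
  (@warp_al_derivable _ eps _ f_smooth f_gt0 _ h_smooth)
  (@warp_be_derivable _ eps _ f_smooth f_gt0 _ h_smooth)
  (@warp_a_derivable _ _ f_smooth f_gt0) p x y z.

Let f2_neq0 t : f t ^+ 2 != 0.
Proof. by rewrite expf_neq0 // lt0r_neq0. Qed.

Let warped_tpart0 (c : R -> R) p v y : tpart v = 0 ->
  warped eps c gF p v y = c (tcoord p) ^+ 2 * G p v y.
Proof. by move=> tv; rewrite warpedE tv mul0r mulr0 add0r. Qed.

Lemma ricci_product p (e : 'M[R]_m) x y :
  (forall i j, gF (projF p) (row i e) (row j e) = (i == j)%:R) ->
  ricci (product_metric eps gF) D0 p x y =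
    \sum_i G p (curv D0 p x (incF (row i e)) (incF (row i e))) y.
Proof.
move=> eE; rewrite product_metric_warped.
rewrite (@ricci_warped _ _ _ _ hgF eps heps (fun=> 1) (fun=> ltr01) _ p e x y
  D0_conn eE).
rewrite (curv_parallel_unit p x unit_t D0_parallel).
rewrite (warped_tpart0 (fun=> 1) p y (tpart0 _ _)) (formF0l hgF) !mulr0 add0r.
apply: eq_bigr => i _; rewrite (warped_tpart0 (fun=> 1)); last first.
  exact: curv_parallel_tpart D0_parallel.
by rewrite !expr1n invr1 !mul1r.
Qed.

Lemma ricci_warped_eq : (forall t, u t = 0) -> ricci g D1 = ricci (product_metric eps gF) D0.
Proof.
move=> u0; have al0 : al = fun=> 0.
  by apply/funext => t; rewrite /warp_al u0 mul0r.
have be0 : be = fun=> 0 by apply/funext => t; rewrite /warp_be u0 mulr0.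
have dcst (t : R) : derive1 (fun _ : R => 0 : R) t = 0 by exact: derive1_cst.
have curvE p x y z : curv D1 p x y z = curv D0 p x y z.
  apply: row_tF_eq.
    rewrite tpart_curv al0 dcst !mul0r subrr mul0r add0r; exact: addr0.
  rewrite Fpart_curv al0 be0 dcst !mulr0 !mul0r addr0 mul0r !scale0r !addr0.
  exact: subr0.
apply/funext => p; apply/funext => x; apply/funext => y.
have [e eE] := formF_onb_exists hgF (projF p).
rewrite (ricci_product x y eE) (ricci_warped hgF heps f_gt0 x y D1_conn eE).
rewrite curvE (curv_parallel_unit p x unit_t D0_parallel).
rewrite (warped_tpart0 f p y (tpart0 _ _)) (formF0l hgF) !mulr0 add0r.
apply: eq_bigr => i _; rewrite curvE warped_tpart0; last first.
  exact: curv_parallel_tpart D0_parallel.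
by rewrite mulrA mulVf // mul1r.
Qed.

Lemma warp_u_eq0 p : (2 <= m)%N ->
  ricci g D1 = ricci (product_metric eps gF) D0 -> u (tcoord p) = 0.
Proof.
move=> m2 E; have [e eE] := formF_onb_exists hgF (projF p).
set t := tcoord p; pose k := derive1 u t + u t * a t.
have eps0 : eps != 0.
  by case: heps => ->; rewrite ?oppr_eq0 oner_neq0.
have Gee i j : G p (incF (row i e)) (incF (row j e)) = (i == j)%:R.
  by rewrite /formF !rsub_incF.
have Hu : tpart (curv D1 p unit_t unit_t unit_t) = 0.
  rewrite tpart_curv (curv_parallel_tpart p unit_t unit_t unit_t D0_parallel).
  by rewrite !(formF_unitr hgF) subrr !mulr0 subrr !mulr0 !addr0.
have Hi i : tpart (curv D1 p unit_t (incF (row i e)) (incF (row i e))) =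
    f t ^+ 2 * k.
  rewrite tpart_curv (curv_parallel_tpart p unit_t _ _ D0_parallel).
  rewrite coord_conn_unit coord_conn_unitr subrr mulr0 addr0 add0r.
  rewrite tpart_unit tpart_incF mul0r mul1r subr0 Gee eqxx mulr1.
  exact: derive_warp_al.
have k0 : k = 0.
  have L : ricci g D1 p unit_t unit_t =
      eps * (eps * 0) + \sum_(i < m) (f t ^+ 2)^-1 * (eps * (f t ^+ 2 * k)).
    rewrite (ricci_warped hgF heps f_gt0 _ _ D1_conn eE); apply: congr2.
      by apply: congr1; apply: (etrans (warped_unitr hgF eps f p _)); rewrite Hu.
    apply: eq_bigr => i _; apply: congr1.
    by apply: (etrans (warped_unitr hgF eps f p _)); rewrite Hi.
  have := congr1 (fun r => r p unit_t unit_t) E.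
  rewrite L (ricci_product _ _ eE) [RHS]big1; last first.
    by move=> i _; exact: formF_unitr.
  rewrite !mulr0 add0r sumr_const card_ord => /eqP; rewrite mulrn_eq0.
  rewrite (gtn_eqF (ltnW m2)) mulf_eq0 invr_eq0 (negbTE (f2_neq0 t)) /=.
  rewrite mulf_eq0 (negbTE eps0) mulf_eq0 (negbTE (f2_neq0 t)) /=.
  exact: eqP.
have db0 : derive1 be t + a t * be t = 0.
  by rewrite (derive_warp_be eps f_smooth f_gt0 h_smooth) -/k k0 mulr0.
pose i0 : 'I_m := Ordinal (ltnW m2); pose x := incF (row i0 e).
have tx : tpart x = 0 by exact: tpart_incF.
have xx : G p x x = 1 by rewrite Gee eqxx.
(* [Fpart_curv] determines the curvature only up to its d/dt part, which the pairing with [x] does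
   not see. *)
have FG v w : rsubmx v = rsubmx w :> 'rV[R]_m -> G p v x = G p w x.
  by rewrite /formF => ->.
have GB v w c : G p (v - c *: w) x = G p v x - c * G p w x.
  by rewrite -scaleNr addrC (formF_linl hgF) mulNr addrC.
have H1 : g p (curv D1 p x unit_t unit_t) x = 0.
  rewrite warped_Fr (FG _ 0) ?(formF0l hgF) ?mulr0 //.
  rewrite Fpart_curv (curv_parallel_unit p x unit_t D0_parallel).
  rewrite coord_conn_unit coord_conn_unitr (formF_unitr hgF) (formF_unitr hgF).
  by rewrite db0 mul0r !scale0r subrr scaler0 subrr scaler0 !addr0 subr0.
have rsubE (A : 'rV[R]_(1 + m)) c v d w :
    rsubmx (A - c *: (v - d *: w)) =
    rsubmx A - c *: (rsubmx v - d *: rsubmx w) :> 'rV[R]_m.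
  by apply/rowP => j; rewrite !mxE.
(* With all arguments tangent to F, the derivative and torsion terms carry a vanishing dt factor.
   The factor 1 - delta is G(x, x) G(y, y) - G(x, y)^2 for members of the orthonormal basis. *)
have H2 i : g p (curv D1 p x (incF (row i e)) (incF (row i e))) x =
    f t ^+ 2 * (G p (curv D0 p x (incF (row i e)) (incF (row i e))) x
      - al t * be t * (1 - (i == i0)%:R)).
  rewrite warped_Fr; apply: congr1.
  pose y := incF (row i e); rewrite -/y.
  apply: (etrans (FG _ (curv D0 p x y y
      - (al t * be t) *: (x - (i == i0)%:R *: y)) _)).
    rewrite Fpart_curv tpart_incF !mulr0 !scale0r !add0r Gee eqxx Gee.
    rewrite rsubE scale1r eq_sym; reflexivity.
  by rewrite GB GB xx Gee; case: eqP => _ /=; rewrite ?mul1r ?mul0r ?subr0.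
have := congr1 (fun r => r p x x) E.
have -> : ricci g D1 p x x = eps * 0 + \sum_(i < m)
    (G p (curv D0 p x (incF (row i e)) (incF (row i e))) x
      - al t * be t * (1 - (i == i0)%:R)).
  rewrite (ricci_warped hgF heps f_gt0 _ _ D1_conn eE); apply: congr2.
    by rewrite H1.
  by apply: eq_bigr => i _; rewrite H2 mulrA mulVf // mul1r.
rewrite (ricci_product _ _ eE) mulr0 add0r sumrB => /eqP.
rewrite -subr_eq0 addrAC subrr sub0r oppr_eq0 -mulr_sumr sumrB sumr_const card_ord.
rewrite (bigD1 i0) //= big1 => [|i /negbTE -> //].
have m1 : m%:R - 1 != 0 :> R by rewrite subr_eq0 pnatr_eq1 gtn_eqF.
rewrite addr0 mulf_eq0 (negbTE m1) orbF /warp_al /warp_be.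
(* al be = eps u^2 f^2, so its vanishing at t forces u(t) = 0. *)
rewrite !mulf_eq0 (negbTE eps0) (negbTE (lt0r_neq0 (f_gt0 t))) !orbF /= orbb.
exact: eqP.
Qed.

End RicciComparison.

Theorem proposition3p6 (R : realType) (n : nat) (hn : (3 <= n)%N)
  (F : manifold R n.-1) (F_nonempty : [set: F] !=set0)
  (gF : F -> 'rV[R]_n.-1 -> 'rV[R]_n.-1 -> R) (hgF : riemannian gF)
  (nablaF : connection F) (hnablaF : levi_civita gF nablaF)
  (omega : F -> 'rV[R]_n.-1 -> 'rV[R]_n.-1 -> 'rV[R]_n.-1)
  (homega : tensor21 omega) (omega_skew : skew21 gF omega)
  (metricF : metric_connection gF (conn_add nablaF omega))
  (skewF : skew_torsion gF (conn_add nablaF omega))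
  (f : R -> R) (f_smooth : smoothR f) (f_gt0 : forall t, 0 < f t)
  (eps : R) (heps : eps = 1 \/ eps = -1)
  (h : R -> R) (h_smooth : smoothR h)
  (nabla_warped nabla_prod : connection (line_product F))
  (hnabla_warped : levi_civita (warped eps f gF) nabla_warped)
  (hnabla_prod : levi_civita (product_metric eps gF) nabla_prod) :
  let V := fun z : line_product F => h (tcoord z) *: partial_t z in
  let D_warped := conn_add (conn_add nabla_warped (pullback omega))
                           (vectorial (warped eps f gF) V) in
  let D_prod := conn_add nabla_prod (pullback omega) in
  ricci (warped eps f gF) D_warped = ricci (product_metric eps gF) D_prod
  <->
  V = (fun z => (eps * (derive1 f (tcoord z) / f (tcoord z))) *: partial_t z).
Proof.
move=> V D_warped D_prod; have m2 : (2 <= n.-1)%N by move: hn; case: (n) => [|[]].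
split=> [ricE|VE].
  apply/funext => z.
  have := warp_u_eq0 hgF heps f_smooth f_gt0 h_smooth homega omega_skew
    hnabla_warped hnabla_prod z m2 ricE.
  by move=> /subr0_eq hz; rewrite /V hz.
apply: (ricci_warped_eq hgF heps f_smooth f_gt0 h_smooth homega omega_skew
  hnabla_warped hnabla_prod) => t.
(* The equality of fields is tested at the point (t, q); a point of F is needed to recover the
   function h at every t. *)
have [q _] := F_nonempty.
have := congr1 (fun W => tpart (W ((t, q) : line_product F))) VE.
rewrite /V !partial_tE !tpartZ tpart_unit !mulr1 /tcoord /= => ht.
by rewrite /warp_u ht subrr.
Qed.
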